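(* Let $\omega=\{\omega_k\}_{k\ge0}$ be a weight sequence, let $T$ be a pure $\omega$-hypercontraction on a Hilbert space $\mathcal H$, and let $(\mathcal E,B,D)$ be a characteristic triple of $T$, with $D=\{D_n\}_{n\ge0}$, $D_n\in\mathcal B(\mathcal E,\mathcal D_{\omega,T})$. Put $\rho_0=1$ and $\rho_n=\frac1{\omega_n}-\frac1{\omega_{n-1}}$ for $n\ge1$. Then $$\theta_T(z)=\sum_{n\ge0}\sqrt{\rho_n}\,D_nz^n+zD_{\omega,T}\sum_{n\ge0}\frac1{\omega_n}z^nT^{*n}B\qquad(z\in\mathbb D)$$ is a partially isometric multiplier in $\mathcal M(H^2_{\mathcal E}(\mathbb D),A^2_\omega(\mathcal D_{\omega,T}))$ such that, with $\mathcal Q_T=\operatorname{ran}\pi_{\omega,T}$, $$\mathcal Q_T^\perp=\theta_TH^2_{\mathcal E}(\mathbb D)\quad\text{and}\quad T\cong P_{\mathcal Q_T}M_z|_{\mathcal Q_T}.$$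
   Context: All Hilbert spaces are complex; $\mathbb D$ is the open unit disc, $\mathbb Z_+=\{0,1,2,\dots\}$. A weight sequence is a decreasing (non-increasing) sequence $\omega=\{\omega_k\}_{k\ge0}$ of positive numbers with $\omega_0=1$, $\liminf_{k\to\infty}\omega_k^{1/k}=1$, such that $k_\omega(z)=\sum_{k\ge0}\frac1{\omega_k}z^k$ has no zeros on $\mathbb D$ and, with $k_{\omega,r}(z)=k_\omega(rz)$: (P1) $k_\omega/k_{\omega,r}$ has non-negative Taylor coefficients for every $0<r<1$; (P2) the Taylor coefficients of $k_{\omega,r}/k_\omega$, $0<r<1$, are uniformly bounded. Write $\frac1{k_\omega(z)}=\sum_{n\ge0}c_nz^n$. $A^2_\omega(\mathcal E)$ is the Hilbert space of analytic $f:\mathbb D\to\mathcal E$, $f(z)=\sum a_kz^k$, with $\|f\|^2=\sum_k\|a_k\|^2\omega_k<\infty$; $M_z$ is multiplication by $z$ on it. $H^2_{\mathcal E}(\mathbb D)$ is the $\mathcal E$-valued Hardy space. A contraction $T\in\mathcal B(\mathcal H)$ is an $\omega$-hypercontraction if $D_{\omega,T}(r):=\sum_{n\ge0}c_nr^nT^nT^{*n}\ge0$ for all $r\in(0,1)$; it is pure if $T^{*n}\to0$ strongly. For an $\omega$-hypercontraction the strong limit $D_{\omega,T}(1)=\lim_{r\to1}D_{\omega,T}(r)\ge 0$ exists; put $D_{\omega,T}=D_{\omega,T}(1)^{1/2}$ and $\mathcal D_{\omega,T}=\overline{\operatorname{ran}}\,D_{\omega,T}$. If $T$ is a pure $\omega$-hypercontraction,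 the map $\pi_{\omega,T}:\mathcal H\to A^2_\omega(\mathcal D_{\omega,T})$, $(\pi_{\omega,T}h)(z)=\sum_{k\ge0}\frac1{\omega_k}(D_{\omega,T}T^{*k}h)z^k$, is an isometry with $\pi_{\omega,T}T^*=M_z^*\pi_{\omega,T}$ (known result of Olofsson). For a pure $\omega$-hypercontraction $T$, with $\rho_n$ as in the statement, $C_{\omega,T}:\mathcal H\to\ell^2(\mathbb Z_+,\mathcal D_{\omega,T})$ is the contraction $C_{\omega,T}h=\{\sqrt{\rho_n}D_{\omega,T}T^{*n}h\}_{n\ge0}$. A characteristic triple of $T$ is a triple $(\mathcal E,B,D)$ consisting of a Hilbert space $\mathcal E$ and bounded operators $B\in\mathcal B(\mathcal E,\mathcal H)$, $D\in\mathcal B(\mathcal E,\ell^2(\mathbb Z_+,\mathcal D_{\omega,T}))$ such that $\begin{bmatrix}T^*&B\\C_{\omega,T}&D\end{bmatrix}:\mathcal H\oplus\mathcal E\to\mathcal H\oplus\ell^2(\mathbb Z_+,\mathcal D_{\omega,T})$ is unitary; $D_n$ denotes the $n$-th component of $D$. $\mathcal M(H^2_{\mathcal E_1}(\mathbb D),A^2_\omega(\mathcal E_2))$ is the set of analytic $\theta:\mathbb D\to\mathcal B(\mathcal E_1,\mathcal E_2)$ with $\theta f\in A^2_\omega(\mathcal E_2)$ for all $f\in H^2_{\mathcal E_1}(\mathbb D)$; such $\theta$ is partially isometric if the multiplication operator $M_\theta f=\theta f$ from $H^2_{\mathcal E_1}(\mathbb D)$ to $A^2_\omega(\mathcal E_2)$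 is a partial isometry. $\cong$ denotes unitary equivalence. *)

(* Defs.v *)
From HB Require Import structures.
From mathcomp Require Import all_boot all_order all_algebra.
From mathcomp Require Import complex.
From mathcomp Require Import all_classical all_reals all_analysis.

Import Order.TTheory GRing.Theory Num.Theory.
Import numFieldNormedType.Exports.

Local Open Scope classical_set_scope.
Local Open Scope complex_scope.
Local Open Scope ring_scope.

(** * Hilbert spaces over [R[i]]

    [R[i]] carries no topology of its own in the libraries, so limits of scalars
    are taken in the regular module [R[i]^o]. The scalar product is linear in
    its first argument. *)

HB.mixin Record CompleteNormedModule_isHilbert (R : realType) (V : Type)
    & CompleteNormedModule R[i] V := {
  hdot : {dot V for (Num.conj : R[i] -> R[i])} ;
  normr_hdot : forall x : V, `|x| ^+ 2 = hdot x x
}.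

#[short(type="hilbertType")]
HB.structure Definition Hilbert (R : realType) :=
  {V of CompleteNormedModule R[i] V & CompleteNormedModule_isHilbert R V}.

Notation "''[' u , v ]" := (hdot u v) (format "''[' u ,  v ]") : ring_scope.

(** * Concrete Hilbert spaces

    A Hilbert space presented as a subspace [carrier] of an ambient module
    together with a scalar product, whose values are relevant on [carrier] only.
    This covers closed subspaces of a Hilbert space, spaces of sequences and
    spaces of analytic functions. *)

Record ipspace (R : realType) := IPSpace {
  ambient : lmodType R[i] ;
  carrier : set ambient ;
  ip : ambient -> ambient -> R[i]
}.
Arguments IPSpace {R ambient} carrier ip.
Arguments ambient {R} X : rename.
Arguments carrier {R} X _ : rename.
Arguments ip {R} X x y : rename.

Section Spaces.
Context {R : realType}.
Local Notation C := R[i].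
Implicit Types X Y : ipspace R.

Definition subhilb {V : hilbertType R} (S : set V) : ipspace R :=
  IPSpace S (fun x y => '[x, y]).

Definition whole (V : hilbertType R) : ipspace R := subhilb [set: V].

Definition dsum X Y : ipspace R :=
  @IPSpace R (ambient X * ambient Y)%type (carrier X `*` carrier Y)
    (fun p q => ip X p.1 q.1 + ip Y p.2 q.2).

Definition subip X (Q : set (ambient X)) : ipspace R := IPSpace Q (ip X).

Definition orthc X (Q : set (ambient X)) : set (ambient X) :=
  [set x | carrier X x /\ forall q, Q q -> ip X x q = 0].

(* The orthogonal projection of [X] onto a closed subspace [Q]. *)
Definition orthproj X (Q : set (ambient X)) (x : ambient X) : ambient X :=
  xget 0 [set q | Q q /\ orthc X Q (x - q)].

(** ** Operators between concrete Hilbert spaces *)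

Definition linear_on X Y (U : ambient X -> ambient Y) : Prop :=
  forall (a : C) (x y : ambient X), carrier X x -> carrier X y ->
    U (a *: x + y) = a *: U x + U y.

Definition bounded_op X Y (U : ambient X -> ambient Y) : Prop :=
  [/\ linear_on X Y U, set_fun (carrier X) (carrier Y) U
    & exists M : R, forall x, carrier X x ->
        ip Y (U x) (U x) <= M%:C * ip X x x].

(* A surjective linear isometry. *)
Definition unitary_op X Y (U : ambient X -> ambient Y) : Prop :=
  [/\ linear_on X Y U, set_fun (carrier X) (carrier Y) U,
      set_surj (carrier X) (carrier Y) U
    & forall x y, carrier X x -> carrier X y -> ip Y (U x) (U y) = ip X x y].

(* A bounded operator that is isometric on the orthogonal complement of its
   kernel. *)
Definition partial_isometry X Y (U : ambient X -> ambient Y) : Prop :=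
  bounded_op X Y U /\
  forall x, orthc X [set k | carrier X k /\ U k = 0] x ->
    ip Y (U x) (U x) = ip X x x.

Definition unitarily_equivalent X (A : ambient X -> ambient X)
    Y (B : ambient Y -> ambient Y) : Prop :=
  exists2 U : ambient X -> ambient Y, unitary_op X Y U &
    forall x, carrier X x -> U (A x) = B (U x).

(** ** Operators on Hilbert spaces *)

(* The adjoint exists, by Riesz representation, as soon as [A] is linear and
   bounded. *)
Definition adjoint {V W : hilbertType R} (A : V -> W) : W -> V :=
  get [set A' : W -> V | forall x y, '[A x, y] = '[x, A' y]].

Definition positive_op {V : hilbertType R} (A : V -> V) : Prop :=
  forall h, 0 <= '[A h, h].

(* The positive square root of a positive operator. *)
Definition sqrt_op {V : hilbertType R} (A : V -> V) : V -> V :=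
  get [set B : V -> V | [/\ bounded_op (whole V) (whole V) B,
                            positive_op B & B \o B = A]].

(** * Spaces of sequences and of analytic functions *)

(* Square-summable sequences with weights [w] and entries in [S]. *)
Definition ell2w_set (w : nat -> R) {V : hilbertType R} (S : set V) :
    set (nat -> V) :=
  [set a | (forall k, S (a k)) /\
    (\sum_(0 <= k <oo) (w k * complex.Re ('[a k, a k]))%:E < +oo)%E].

Definition ell2w_ip (w : nat -> R) {V : hilbertType R} (a b : nat -> V) : C :=
  lim (series (fun k => (w k)%:C * '[a k, b k] : C^o) @ \oo).

Definition ell2 {V : hilbertType R} (S : set V) : ipspace R :=
  IPSpace (ell2w_set (fun=> 1) S) (@ell2w_ip (fun=> 1) V).

Definition disc : Type := {z : C | `|z| < 1}.

Definition power_expansion {V : hilbertType R} (f : disc -> V)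
    (a : nat -> V) : Prop :=
  forall z : disc, series (fun k => sval z ^+ k *: a k) @ \oo --> f z.

Definition coefficients {V : hilbertType R} (f : disc -> V) : nat -> V :=
  xget 0 [set a | power_expansion f a].

(* The space of analytic [f : disc -> S], [f z = \sum_k a_k z^k], with
   [\sum_k w_k * `|a_k|^2 < +oo]. As [S] is meant to be a closed subspace, [f]
   takes its values in [S] exactly when its coefficients lie in [S]. *)
Definition A2 (w : nat -> R) {V : hilbertType R} (S : set V) : ipspace R :=
  IPSpace
    [set f : disc -> V | exists2 a, power_expansion f a & ell2w_set w S a]
    (fun f g => ell2w_ip w (coefficients f) (coefficients g)).

Definition H2 (V : hilbertType R) : ipspace R := A2 (fun=> 1) [set: V].

Definition Mz {V : hilbertType R} (f : disc -> V) : disc -> V :=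
  fun z => sval z *: f z.

Definition mulop {V W : hilbertType R} (theta : disc -> V -> W)
    (f : disc -> V) : disc -> W :=
  fun z => theta z (f z).

(* Analytic functions from the disc to the bounded operators [V -> S]: sums of a
   power series that converges in operator norm at each point of the disc. *)
Definition analytic_op {V W : hilbertType R} (S : set W)
    (theta : disc -> V -> W) : Prop :=
  exists2 Theta : nat -> V -> W,
    forall n, bounded_op (whole V) (subhilb S) (Theta n) &
    forall (z : disc) (e : R), 0 < e ->
      \forall n \near \oo, forall x : V,
        `|series (fun k => sval z ^+ k *: Theta k x) n - theta z x|
          <= e%:C * `|x|.

(* [M(H^2_V, A^2_w(S))], for a closed subspace [S] of [W]. *)
Definition multiplier (w : nat -> R) {V W : hilbertType R} (S : set W)
    (theta : disc -> V -> W) : Prop :=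
  [/\ forall z, bounded_op (whole V) (subhilb S) (theta z),
      analytic_op S theta
    & forall f, carrier (H2 V) f -> carrier (A2 w S) (mulop theta f)].

Definition partially_isometric_multiplier (w : nat -> R)
    {V W : hilbertType R} (S : set W) (theta : disc -> V -> W) : Prop :=
  multiplier w S theta /\
  partial_isometry (H2 V) (A2 w S) (mulop theta).

(** * Weight sequences *)

(* Taylor coefficients at the origin of a function analytic near the origin,
   and 0 if there is no expansion. The quotients below all have one, as
   [kfun w 0 = 1]. *)
Definition taylor (F : C -> C) : nat -> C :=
  xget (fun=> 0)
    [set a : nat -> C | \forall z \near (0 : C^o),
      series (fun n => a n * z ^+ n : C^o) @ \oo --> (F z : C^o)].

Definition kfun (w : nat -> R) (z : C) : C :=
  lim (series (fun k => (w k)^-1%:C * z ^+ k : C^o) @ \oo).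

Definition kfunr (w : nat -> R) (r : R) (z : C) : C := kfun w (r%:C * z).

Definition weight_sequence (w : nat -> R) : Prop :=
  [/\ [/\ w 0%N = 1, forall k, 0 < w k, forall k, w k.+1 <= w k
        & limn_einf (fun k => (w k `^ (k%:R)^-1)%:E) = 1%:E],
      forall z : C, `|z| < 1 -> kfun w z != 0,
      forall r : R, 0 < r < 1 -> forall n,
        0 <= taylor (fun z => kfun w z / kfunr w r z) n
    & exists M : R, forall r : R, 0 < r < 1 -> forall n,
        `|taylor (fun z => kfunr w r z / kfun w z) n| <= M%:C].

Definition cseq (w : nat -> R) : nat -> C := taylor (fun z => (kfun w z)^-1).

Definition rho (w : nat -> R) (n : nat) : R :=
  if n is m.+1 then (w m.+1)^-1 - (w m)^-1 else 1.

(** * Hypercontractions *)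

Section Hypercontraction.
Context {H : hilbertType R}.
Variables (w : nat -> R) (T : H -> H).

(* The series is a strong limit; for a contraction [T] it is also the limit in
   operator norm. *)
Definition defect_r (r : R) (h : H) : H :=
  lim (series (fun n =>
    (cseq w n * r%:C ^+ n) *: iter n T (iter n (adjoint T) h)) @ \oo).

Definition hypercontraction : Prop :=
  [/\ bounded_op (whole H) (whole H) T,
      forall h, `|T h| <= `|h|
    & forall r : R, 0 < r < 1 -> positive_op (defect_r r)].

Definition pure : Prop :=
  forall h, (fun n => iter n (adjoint T) h) @ \oo --> (0 : H).

Definition defect1 (h : H) : H := lim (defect_r r h @[r --> 1^'-]).

Definition defect : H -> H := sqrt_op defect1.

Definition defect_space : set H := closure (range defect).

Definition pi_map (h : H) : disc -> H := fun z =>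
  lim (series (fun k =>
    ((w k)^-1%:C * sval z ^+ k) *: defect (iter k (adjoint T) h)) @ \oo).

Definition Cmap (h : H) : nat -> H := fun n =>
  (Num.sqrt (rho w n))%:C *: defect (iter n (adjoint T) h).

Section Triple.
Context {E : hilbertType R}.
Variables (B : E -> H) (D : E -> nat -> H).

Definition characteristic_triple : Prop :=
  [/\ bounded_op (whole E) (whole H) B,
      bounded_op (whole E) (ell2 defect_space) D
    & unitary_op (dsum (whole H) (whole E))
                 (dsum (whole H) (ell2 defect_space))
        (fun p => (adjoint T p.1 + B p.2, Cmap p.1 + D p.2))].

Definition theta_fun (z : disc) (x : E) : H :=
  lim (series (fun n =>
    ((Num.sqrt (rho w n))%:C * sval z ^+ n) *: D x n) @ \oo)
  + sval z *: defect (lim (series (fun n =>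
      ((w n)^-1%:C * sval z ^+ n) *: iter n (adjoint T) (B x)) @ \oo)).

End Triple.
End Hypercontraction.
End Spaces.

(* Main.v *)
(** The unitary [(h, x) |-> (T^* h + B x, C h + D x)] is read as one step of a linear
    system with state [h], input [x] and output in [ell2]. Running it from the state [h] on
    the input sequence [x] and adding up the outputs, with weights [sqrt (rho n)] along the
    antidiagonals, produces exactly the Taylor coefficients of [pi h + theta x]
    (lemma [genS]). Energy conservation and the Cauchy-Schwarz inequality for
    [rho (n+1) + 1 / w n = 1 / w (n+1)] make [(h, x) |-> pi h + theta x] a contraction.
    Telescoping [|C h|^2 = |h|^2 - |T^* h|^2] and purity make [pi] isometric, so
    [ran pi] is orthogonal to [ran theta]. Conversely, running the system backwards from
    the final state [0] (this uses surjectivity) writes every [g] as [pi h + theta x] with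
    [|h|^2 + |x|^2 <= |g|^2]. Hence [ran theta] is the orthogonal complement of [ran pi],
    and every [g] in it has a preimage of norm at most [|g|], which makes [theta] partially
    isometric. Finally [pi T^* = M_z^* pi] turns [T] into the compression of [M_z]. *)
Require Import Defs.
From mathcomp Require Import all_boot all_order all_algebra.
From mathcomp Require Import complex.
From mathcomp Require Import all_classical all_reals all_analysis.
From mathcomp Require Import ring lra.
Set Implicit Arguments.
Unset Strict Implicit.
Unset Printing Implicit Defensive.

Import Order.TTheory GRing.Theory Num.Theory.
Import numFieldNormedType.Exports.
Local Open Scope classical_set_scope.
Local Open Scope complex_scope.
Local Open Scope ring_scope.

(** * Hilbert spaces as real inner product spaces *)

Section ComplexParts.
Context {R : realType}.
Implicit Types (a b : R[i]) (t : R).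

(** The decisive point is the equality case of the Cauchy-Schwarz step. It occurs when the output at
    each time is [sqrt (rho n)] times one shared sequence [u], read from the current time on. The
    weights along an antidiagonal then add up to [1 / w n], the contraction bound becomes an
    identity, and a target sequence [a] forces [u n = w n * a n]. A backward run needs a last time,
    so [a] is truncated; the identity for differences of runs lets the truncation be removed. The
    operators [adjoint T] and [defect] are given only by choice. The adjoint is secured by Riesz
    representation, while linearity and bounds for [defect] are read off the unitary. The argument
    lives on coefficient sequences; uniqueness of power expansions and a product theorem for [theta]
    carry it over to functions. *)

Lemma ReD a b : complex.Re (a + b) = complex.Re a + complex.Re b.
Proof. by case: a b => [? ?] [? ?]. Qed.

Lemma ImD a b : complex.Im (a + b) = complex.Im a + complex.Im b.
Proof. by case: a b => [? ?] [? ?]. Qed.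

Lemma Re_conj a : complex.Re a^* = complex.Re a.
Proof. by case: a. Qed.

Lemma Im_conj a : complex.Im a^* = - complex.Im a.
Proof. by case: a. Qed.

Lemma ReM_real t a : complex.Re (t%:C * a) = t * complex.Re a.
Proof. by case: a => x y /=; rewrite mul0r subr0. Qed.

Lemma ImM_real t a : complex.Im (t%:C * a) = t * complex.Im a.
Proof. by case: a => x y /=; rewrite mul0r addr0. Qed.

Lemma Re_sum (F : nat -> R[i]) n :
  complex.Re (\sum_(0 <= k < n) F k) = \sum_(0 <= k < n) complex.Re (F k).
Proof.
elim: n => [|n IH]; first by rewrite !big_geq.
by rewrite !big_nat_recr//= ReD IH.
Qed.

Lemma Im_sum (F : nat -> R[i]) n :
  complex.Im (\sum_(0 <= k < n) F k) = \sum_(0 <= k < n) complex.Im (F k).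
Proof.
elim: n => [|n IH]; first by rewrite !big_geq.
by rewrite !big_nat_recr//= ImD IH.
Qed.

Lemma complex_eq a b :
  complex.Re a = complex.Re b -> complex.Im a = complex.Im b -> a = b.
Proof. by case: a b => [? ?] [? ?] /= -> ->. Qed.

Definition csq a : R := complex.Re a ^+ 2 + complex.Im a ^+ 2.

Lemma csq_ge0 a : 0 <= csq a.
Proof. by rewrite addr_ge0 ?sqr_ge0. Qed.

Lemma csqM a b : csq (a * b) = csq a * csq b.
Proof. case: a b => [a1 a2] [b1 b2]; rewrite /csq /=; ring. Qed.

Lemma csq_real t : csq t%:C = t ^+ 2.
Proof. by rewrite /csq /= expr0n addr0. Qed.

(** The norm of [R[i]] has values in [R[i]]; this copy with values in [R] lets geometric bounds be
    stated over the reals. *)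
Definition cmod a : R := Num.sqrt (csq a).

Lemma cmodE a : `|a| = (cmod a)%:C.
Proof. exact: normc_def. Qed.

Lemma cmod_ge0 a : 0 <= cmod a.
Proof. exact: sqrtr_ge0. Qed.

Lemma cmodM a b : cmod (a * b) = cmod a * cmod b.
Proof. by rewrite /cmod csqM sqrtrM ?csq_ge0. Qed.

Lemma cmod_real t : 0 <= t -> cmod t%:C = t.
Proof. by move=> t0; rewrite /cmod csq_real sqrtr_sqr ger0_norm. Qed.

Lemma cmodX a n : cmod (a ^+ n) = cmod a ^+ n.
Proof.
elim: n => [|n IH]; last by rewrite !exprS cmodM IH.
by rewrite !expr0 (cmod_real ler01).
Qed.

End ComplexParts.

Section HilbertBasics.
Context {R : realType} {V : hilbertType R}.
Implicit Types (x y z : V) (a : R[i]) (t : R).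

Lemma hdotDl x y z : '[x + y, z] = '[x, z] + '[y, z] :> R[i].
Proof. exact: linearDl. Qed.

Lemma hdotZl a x z : '[a *: x, z] = a * '[x, z] :> R[i].
Proof. exact: linearZl_LR. Qed.

Lemma hdotC x y : '[x, y] = ('[y, x])^* :> R[i].
Proof. by rewrite (hermC (@hdot R V) x y) expr0 mul1r. Qed.

Lemma hdotDr x y z : '[x, y + z] = '[x, y] + '[x, z] :> R[i].
Proof. by rewrite hdotC hdotDl rmorphD /= -!hdotC. Qed.

Lemma hdotZr a x z : '[x, a *: z] = a^* * '[x, z] :> R[i].
Proof. by rewrite hdotC hdotZl rmorphM /= -!hdotC. Qed.

Lemma hdot0r x : '[x, 0] = 0 :> R[i].
Proof. by rewrite -(scale0r x) hdotZr conjC0 mul0r. Qed.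

(* Estimates are made with this real inner product; [Im_hdot] recovers the complex one. *)
Definition rdot x y : R := complex.Re '[x, y].
Definition nsq x : R := rdot x x.
Definition nm x : R := Num.sqrt (nsq x).

Lemma rdotC x y : rdot x y = rdot y x.
Proof. by rewrite /rdot hdotC Re_conj. Qed.

Lemma rdotDl x y z : rdot (x + y) z = rdot x z + rdot y z.
Proof. by rewrite /rdot hdotDl ReD. Qed.

Lemma rdotDr x y z : rdot x (y + z) = rdot x y + rdot x z.
Proof. by rewrite /rdot hdotDr ReD. Qed.

Lemma rdotZl t x y : rdot (t%:C *: x) y = t * rdot x y.
Proof. by rewrite /rdot hdotZl ReM_real. Qed.

Lemma rdotZr t x y : rdot x (t%:C *: y) = t * rdot x y.
Proof. by rewrite rdotC rdotZl rdotC. Qed.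

Lemma rdotNl x y : rdot (- x) y = - rdot x y.
Proof. by rewrite -scaleN1r -(rmorphN1 (real_complex R)) rdotZl mulN1r. Qed.

Lemma rdotNr x y : rdot x (- y) = - rdot x y.
Proof. by rewrite rdotC rdotNl rdotC. Qed.

Lemma Im_hdot x y : complex.Im '[x, y] = rdot x ('i *: y).
Proof.
rewrite /rdot hdotZr conjCi -complexiE.
by case: ('[x, y]) => u v /=; rewrite oppr0 mul0r sub0r mulN1r opprK.
Qed.

Lemma hdot_nsq x : '[x, x] = (nsq x)%:C.
Proof.
apply: complex_eq => //=; have := congr1 (@complex.Im R) (hdotC x x).
by rewrite Im_conj; lra.
Qed.

Lemma norm_sqr x : `|x| ^+ 2 = (nsq x)%:C.
Proof. by rewrite normr_hdot hdot_nsq. Qed.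

Lemma nsq_ge0 x : 0 <= nsq x.
Proof. by rewrite -ler0c -norm_sqr exprn_ge0. Qed.

Lemma nm_ge0 x : 0 <= nm x. Proof. exact: sqrtr_ge0. Qed.

Lemma nm2 x : nm x ^+ 2 = nsq x. Proof. by rewrite sqr_sqrtr ?nsq_ge0. Qed.

Lemma normE x : `|x| = (nm x)%:C.
Proof.
apply/eqP; rewrite -(@eqrXn2 _ 2) ?ler0c ?nm_ge0// norm_sqr -nm2.
by rewrite rmorphXn.
Qed.

Lemma nsq_eq0 x : nsq x = 0 -> x = 0.
Proof. by move=> x0; apply/normr0_eq0; rewrite normE /nm x0 sqrtr0. Qed.

Lemma nsq0 : nsq 0 = 0.
Proof. by rewrite /nsq /rdot hdot0r. Qed.

Lemma nm0 : nm 0 = 0. Proof. by rewrite /nm nsq0 sqrtr0. Qed.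

Lemma nsqD x y : nsq (x + y) = nsq x + 2 * rdot x y + nsq y.
Proof. rewrite /nsq !rdotDl !rdotDr (rdotC y x); ring. Qed.

Lemma nsqN x : nsq (- x) = nsq x.
Proof. by rewrite /nsq rdotNl rdotNr opprK. Qed.

Lemma nsqB x y : nsq (x - y) = nsq x - 2 * rdot x y + nsq y.
Proof. by rewrite nsqD nsqN rdotNr mulrN. Qed.

Lemma nsqZ a x : nsq (a *: x) = csq a * nsq x.
Proof.
rewrite /nsq /rdot hdotZl hdotZr hdot_nsq mulrA.
case: a => u v; rewrite /csq /=; ring.
Qed.

Lemma nsqZr t x : nsq (t%:C *: x) = t ^+ 2 * nsq x.
Proof. by rewrite nsqZ csq_real. Qed.

Lemma nmZ a x : nm (a *: x) = cmod a * nm x.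
Proof. by rewrite /nm nsqZ sqrtrM ?csq_ge0. Qed.

Lemma nmN x : nm (- x) = nm x.
Proof. by rewrite /nm nsqN. Qed.

Lemma nmD x y : nm (x + y) <= nm x + nm y.
Proof. by rewrite -lecR rmorphD /= -!normE ler_normD. Qed.

Lemma nmB x y : nm (x - y) = nm (y - x).
Proof. by rewrite -nmN opprB. Qed.

Lemma nm_eq0 x : nm x = 0 -> x = 0.
Proof. by move=> x0; apply: nsq_eq0; rewrite -nm2 x0 expr0n. Qed.

Lemma ler_nm x t : 0 <= t -> nsq x <= t ^+ 2 -> nm x <= t.
Proof. by move=> t0; rewrite -nm2 ler_pXn2r ?nnegrE ?nm_ge0. Qed.

Lemma ler_nsq x t : nm x <= t -> nsq x <= t ^+ 2.
Proof.
move=> xt; rewrite -nm2 ler_pXn2r ?nnegrE ?nm_ge0//.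
exact: le_trans (nm_ge0 x) xt.
Qed.

Lemma rdot_le x y : 2 * `|rdot x y| <= nsq x + nsq y.
Proof.
have := nsq_ge0 (x + y); have := nsq_ge0 (x - y); rewrite nsqB nsqD.
by move=> h1 h2; rewrite -ler_pdivlMl// ler_norml; apply/andP; split; lra.
Qed.

Lemma rdot_le_nm x y : `|rdot x y| <= nm x * nm y.
Proof.
have [x0|x0] := eqVneq (nm x) 0.
  rewrite (nm_eq0 x0) nm0 mul0r rdotC.
  by rewrite /rdot hdot0r normr0.
have [y0|y0] := eqVneq (nm y) 0.
  by rewrite (nm_eq0 y0) nm0 mulr0 /rdot hdot0r normr0.
have xp : 0 < nm x by rewrite lt_def x0 nm_ge0.
have yp : 0 < nm y by rewrite lt_def y0 nm_ge0.
(* Scaling each vector by the norm of the other equalises their norms, which makes the arithmetic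
   mean bound sharp. *)
have := rdot_le ((nm y)%:C *: x) ((nm x)%:C *: y).
rewrite rdotZl rdotZr !nsqZr -!nm2 !normrM !(gtr0_norm xp) !(gtr0_norm yp).
have -> : nm y ^+ 2 * nm x ^+ 2 + nm x ^+ 2 * nm y ^+ 2
   = 2 * (nm y * (nm x * (nm x * nm y))) by ring.
by rewrite ler_pM2l// ler_pM2l// ler_pM2l.
Qed.

Lemma nsqD_le x y : nsq (x + y) <= 2 * (nsq x + nsq y).
Proof. have := nsq_ge0 (x - y); rewrite nsqB nsqD; lra. Qed.

Lemma rdot_polar x y : rdot x y = (nsq (x + y) - nsq (x - y)) / 4.
Proof. rewrite nsqB nsqD; lra. Qed.

Lemma hdot_ext x y : (forall z, rdot z x = rdot z y) -> x = y.
Proof.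
move=> xy; apply/eqP; rewrite -subr_eq0; apply/eqP/nsq_eq0.
by rewrite /nsq rdotDr rdotNr xy subrr.
Qed.

End HilbertBasics.

(** * Limits in norm and geometric series *)

Section Limits.
Context {R : realType} {V : hilbertType R}.
Implicit Types (u v : nat -> V) (l : V).

(** Radii of balls lie in [R[i]], where positivity forces the imaginary part to vanish, so real
    radii suffice. *)
Lemma hcvgP u l : u @ \oo --> l <->
  forall e : R, 0 < e -> exists N, forall n, (N <= n)%N -> nm (u n - l) < e.
Proof.
split=> [/cvgrPdist_lt ul e e0|ul].
  have [|N _ uN] := ul e%:C; first by rewrite ltcR.
  by exists N => n /uN /=; rewrite normE ltcR nmB.
apply/cvgrPdist_lt => -[e e'].
rewrite ltcE /= => /andP[/eqP e'0 e0].
have [N uN] := ul e e0.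
by exists N => // n /= /uN; rewrite normE nmB ltcE /= e'0 eqxx.
Qed.

Lemma hcvg_le u l (s : nat -> R) : (forall n, nm (u n - l) <= s n) ->
  s @ \oo --> (0 : R) -> u @ \oo --> l.
Proof.
move=> us /cvgrPdist_lt s0; apply/hcvgP => e e0.
have [N _ sN] := s0 e e0; exists N => n /sN /=.
rewrite sub0r normrN => /(le_lt_trans (ler_norm _)).
exact: le_lt_trans.
Qed.

Lemma hcvg_unique u l l' : u @ \oo --> l -> u @ \oo --> l' -> l = l'.
Proof. exact: cvg_unique. Qed.

Lemma hcauchy u :
  (forall e : R, 0 < e -> exists N, forall n m, (N <= n)%N -> (n <= m)%N ->
    nm (u m - u n) < e) ->
  exists l, u @ \oo --> l.
Proof.
move=> cu; suff : cvg (u @ \oo) by move=> h; exists (lim (u @ \oo)).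
apply/cauchy_cvgP/cauchy_ballP => -[e e'].
rewrite ltcE /= => /andP[/eqP e'0 e0].
have [N uN] := cu e e0.
exists (u @` [set n | (N <= n)%N], u @` [set n | (N <= n)%N]) => /=.
  by split; exists N => // n Nn; exists n.
move=> [_ _] [/= [n Nn <-] [m Nm <-]]; rewrite -ball_normE /ball_ /= normE ltcE /= e'0 eqxx /=.
by case: (leqP n m) => nm_; [rewrite nmB|]; apply: uN => //; exact: ltnW.
Qed.

Lemma nm_lim_le u l (M : R) : u @ \oo --> l ->
  (exists N, forall n, (N <= n)%N -> nm (u n) <= M) -> nm l <= M.
Proof.
move=> /hcvgP ul [N uM]; apply/ler_addgt0Pr => e e0.
have [N' uN] := ul e e0; pose n := maxn N N'.
have := uN n (leq_maxr _ _); have := uM n (leq_maxl _ _).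
have : nm (u n - (u n - l)) <= nm (u n) + nm (u n - l).
  by apply: le_trans (nmD _ _) _; rewrite nmN.
by rewrite opprB addrCA subrr addr0; lra.
Qed.

Lemma cvg_rdot u l y : u @ \oo --> l -> (fun n => rdot (u n) y) @ \oo --> rdot l y.
Proof.
move=> /hcvgP ul; apply/cvgrPdist_lt => e e0.
have y0 : 0 < nm y + 1 by rewrite ltr_wpDl ?nm_ge0.
have [|N uN] := ul (e / (nm y + 1)); first by rewrite divr_gt0.
exists N => // n /= /uN; rewrite ltr_pdivlMr// => h.
rewrite -rdotNl -rdotDl; apply: le_lt_trans (rdot_le_nm _ _) _.
apply: le_lt_trans h; rewrite nmB ler_wpM2l ?nm_ge0//.
by rewrite lerDl.
Qed.

Lemma geometric_cvg0 (K q : R) : 0 <= q < 1 -> (fun n => K * q ^+ n) @ \oo --> (0 : R).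
Proof.
move=> /andP[q0 q1]; apply: cvg_geometric; by rewrite ger0_norm.
Qed.

Lemma geometric_dist v (K q : R) : 0 <= q < 1 -> (forall n, nm (v n) <= K * q ^+ n) ->
  forall n m, (n <= m)%N -> nm (series v m - series v n) <= K / (1 - q) * q ^+ n.
Proof.
move=> /andP[q0 q1] vK n m nm_.
have K0 : 0 <= K by have := vK 0%N; rewrite expr0 mulr1; apply: le_trans (nm_ge0 _).
have q1' : 0 < 1 - q by rewrite subr_gt0.
(* With [q ^+ n - q ^+ m] the bound telescopes exactly: one more term costs [K * q ^+ p = K / (1 -
   q) * (q ^+ p - q ^+ p.+1)]. *)
suff : nm (series v m - series v n) <= K / (1 - q) * (q ^+ n - q ^+ m).
  move/le_trans; apply; apply: ler_wpM2l; first by rewrite divr_ge0// ltW.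
  by rewrite gerBl exprn_ge0.
rewrite -(subnKC nm_); elim: (m - n)%N => [|k IH].
  by rewrite addn0 !subrr nm0 mulr0.
rewrite addnS; set p := (n + k)%N in IH *.
have -> : series v p.+1 - series v n = (series v p - series v n) + v p.
  by rewrite /series /= big_nat_recr//= addrAC.
apply: le_trans (nmD _ _) _.
apply: le_trans (lerD IH (vK p)) _; rewrite le_eqVlt; apply/orP; left; apply/eqP.
by rewrite exprS; field; lra.
Qed.

Lemma geometric_series v (K q : R) : 0 <= q < 1 ->
    (forall n, nm (v n) <= K * q ^+ n) ->
  exists2 l, series v @ \oo --> l &
    forall n, nm (series v n - l) <= K / (1 - q) * q ^+ n.
Proof.
move=> q01 vK; have dist := geometric_dist q01 vK.
have [|l vl] := @hcauchy (series v).
  move=> e e0; have /cvgrPdist_lt := geometric_cvg0 (K / (1 - q)) q01.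
  move=> /(_ e e0)[N _ hN]; exists N => n m Nn nm_.
  apply: le_lt_trans (dist _ _ nm_) _; have := hN n Nn => /=.
  by rewrite sub0r normrN; apply: le_lt_trans; exact: ler_norm.
exists l => // n.
have : (fun m => series v m - series v n) @ \oo --> l - series v n.
  by apply: cvgB => //; exact: cvg_cst.
rewrite nmB => /nm_lim_le; apply; exists n => m; exact: dist.
Qed.

Lemma geometric_series_cvg v (K q : R) : 0 <= q < 1 ->
    (forall n, nm (v n) <= K * q ^+ n) ->
  series v @ \oo --> lim (series v @ \oo).
Proof. by move=> q01 /(geometric_series q01)[l vl _]; apply/cvg_ex; exists l. Qed.

Lemma seriesD u v : series (u + v) = series u + series v.
Proof. by apply/funext => n; rewrite /series /= fctE big_split. Qed.

Lemma seriesZ a u : series (a *: u) = a *: series u.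
Proof. by apply/funext => n; rewrite /series /= !fctE scaler_sumr. Qed.

Lemma series_linear a u v l l' : series u @ \oo --> l -> series v @ \oo --> l' ->
  series (a *: u + v) @ \oo --> a *: l + l'.
Proof.
move=> ul vl; rewrite seriesD seriesZ; apply: cvgD => //.
exact: cvgZ (cvg_cst _) ul.
Qed.

Lemma series_shift v l : series v @ \oo --> l ->
  series (fun n => v n.+1) @ \oo --> l - v 0%N.
Proof.
move=> vl; have -> : series (fun n => v n.+1) = (fun n => series v n.+1 - v 0%N).
  by apply/funext => n; rewrite /series /= big_nat_recl// addrAC subrr add0r.
by apply: cvgB (cvg_cst _); rewrite (cvg_shiftS (series v)).
Qed.

End Limits.

Section LinearMaps.
Context {R : realType} {V W : hilbertType R}.

Lemma bounded_linear_cvg (A : V -> W) (M : R) u l :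
  (forall x y, A (x - y) = A x - A y) -> (forall x, nm (A x) <= M * nm x) ->
  u @ \oo --> l -> (fun n => A (u n)) @ \oo --> A l.
Proof.
move=> AB AM /hcvgP ul; apply/hcvgP => e e0.
have M0 : 0 < `|M| + 1 by rewrite ltr_wpDl.
have [|N uN] := ul (e / (`|M| + 1)); first by rewrite divr_gt0.
exists N => n /uN; rewrite ltr_pdivlMr// mulrC => h.
rewrite -AB; apply: le_lt_trans (AM _) _; apply: le_lt_trans h.
by rewrite ler_wpM2r ?nm_ge0// (le_trans (ler_norm _))// lerDl.
Qed.

End LinearMaps.

Lemma quadratic_ge0_eq0 (R : realFieldType) (a c : R) : 0 <= a ->
  (forall t : R, 0 <= 2 * t * c + t ^+ 2 * a) -> c = 0.
Proof.
(* The minimiser would be [- c / a]; [a + 1] also covers [a = 0] and still gives a negative value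
   unless [c = 0]. *)
move=> a0 /(_ (- c / (a + 1))) h.
have a1 : 0 < a + 1 by rewrite ltr_wpDl.
have : 0 <= - (c ^+ 2) * (a + 2).
  have -> : - (c ^+ 2) * (a + 2) =
     (a + 1) ^+ 2 * (2 * (- c / (a + 1)) * c + (- c / (a + 1)) ^+ 2 * a).
    by field; rewrite gt_eqF.
  by rewrite mulr_ge0 ?sqr_ge0.
rewrite mulNr oppr_ge0 => c0; apply/eqP; rewrite -sqrf_eq0.
rewrite eq_le sqr_ge0 andbT -(@pmulr_lle0 _ (a + 2))// ltr_wpDl//.
Qed.

(** * Riesz representation and adjoints *)

Section Riesz.
Context {R : realType} {V : hilbertType R}.

(* The representing vector minimises [nsq x - 2 * phi x]. *)
Lemma riesz (phi : V -> R) (M : R) :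
    (forall x y, phi (x + y) = phi x + phi y) ->
    (forall (t : R) x, phi (t%:C *: x) = t * phi x) ->
    (forall x, `|phi x| <= M * nm x) ->
  exists z, forall x, phi x = rdot x z.
Proof.
move=> phiD phiZ phiM; pose J x := nsq x - 2 * phi x.
have JM x : - M ^+ 2 <= J x.
  have h : phi x <= M * nm x by apply: le_trans (ler_norm _) (phiM x).
  have := sqr_ge0 (nm x - M); rewrite /J -nm2; nra.
have hasJ : has_inf (range J).
  by split; [exists (J 0); exists 0 | exists (- M ^+ 2) => _ [x _ <-]].
pose m := inf (range J).
have mJ x : m <= J x by apply: (ge_inf hasJ.2); exists x.
have [eps [eps_gt0 inv0]] : exists eps : nat -> R,
    (forall n, 0 < eps n) /\ eps @ \oo --> (0 : R).
  exists harmonic; split; last exact: cvg_harmonic.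
  by move=> n; rewrite /= invr_gt0.
have /choice[v vP] : forall n : nat, exists x, J x < m + eps n.
  move=> n; have [_ [x _ <-] Jx] := @inf_adherent _ _ (eps n) (eps_gt0 n) hasJ.
  by exists x.
(* Parallelogram law for [J], whose linear part cancels: points that nearly minimise [J] are close
   together, so [v] is a Cauchy sequence. *)
have par x y : nsq (x - y) = 2 * J x + 2 * J y - 4 * J ((2^-1 : R)%:C *: (x + y)).
  by rewrite /J phiZ phiD nsqZr nsqB nsqD; field.
have [|z vz] := @hcauchy R V v.
  move=> e e0.
  have e20 : 0 < e ^+ 2 / 4 by rewrite divr_gt0// exprn_gt0.
  have /cvgrPdist_lt /(_ _ e20) [N _ hN] := inv0.
  exists N => n k Nn nk; have Nk := leq_trans Nn nk.
  have := hN n Nn; have := hN k Nk => /=.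
  rewrite !sub0r !normrN !ger0_norm ?(ltW (eps_gt0 _))// => ek en.
  rewrite -(@ltr_pXn2r _ 2) ?nnegrE ?nm_ge0 ?(ltW e0)// nm2 par.
  have := mJ ((2^-1 : R)%:C *: (v k + v n)); have := vP n; have := vP k; lra.
exists z => x; apply/esym/eqP; rewrite -subr_eq0; apply/eqP.
apply: (quadratic_ge0_eq0 (nsq_ge0 x)) => t.
(* First variation at the minimiser, as the limit of [m <= J (v n + t x)] combined with
   [J (v n) < m + eps n]. *)
have /cvgr_to_ge : (fun n => eps n + (2 * t * (rdot (v n) x - phi x) + t ^+ 2 * nsq x))
    @ \oo --> 0 + (2 * t * (rdot z x - phi x) + t ^+ 2 * nsq x).
  apply: cvgD => //; apply: cvgD; last exact: cvg_cst.
  apply: cvgM; first exact: cvg_cst.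
  apply: cvgB; last exact: cvg_cst.
  exact: cvg_rdot.
move=> /(_ 0); rewrite add0r (rdotC x z); apply.
near=> n; have := mJ (v n + t%:C *: x); have := vP n.
rewrite /J phiD phiZ nsqD rdotZr nsqZr; lra.
Unshelve. all: by end_near. Qed.

(** Since [adjoint] is a [get], its defining property requires a witness. Riesz gives one for the
    real parts, and replacing [x] by ['i *: x] gives the imaginary parts. *)
Lemma adjoint_exists {W : hilbertType R} (A : V -> W) (M : R) :
    (forall a x y, A (a *: x + y) = a *: A x + A y) ->
    (forall x, nm (A x) <= M * nm x) ->
  forall x y, '[A x, y] = '[x, adjoint A y] :> R[i].
Proof.
move=> Alin AM.
have A0 : A 0 = 0 by have := Alin 1 0 0; rewrite !scale1r addr0 => /eqP; rewrite -subr_eq subrr => /eqP.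
have AZ a x : A (a *: x) = a *: A x by have := Alin a x 0; rewrite A0 !addr0.
have AD x y : A (x + y) = A x + A y by have := Alin 1 x y; rewrite !scale1r.
have /choice[A' A'P] : forall y, exists z, forall x, rdot (A x) y = rdot x z.
  move=> y; apply: (@riesz (fun x => rdot (A x) y) (M * nm y)).
  - by move=> x x'; rewrite AD rdotDl.
  - by move=> t x; rewrite AZ rdotZl.
  - move=> x; apply: le_trans (rdot_le_nm _ _) _.
    by rewrite mulrAC ler_wpM2r ?nm_ge0.
have : [set A' : W -> V | forall x y, '[A x, y] = '[x, A' y] :> R[i]] !=set0.
  exists A' => x y; apply: complex_eq; first exact: A'P.
  have ImE (U : hilbertType R) (u v : U) : complex.Im '[u, v] = - rdot ('i *: u) v.
    by rewrite /rdot hdotZl -complexiE; case: ('[u, v]) => s t /=; lra.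
  by rewrite !ImE -A'P AZ.
exact: (@getPex _ [set A' : W -> V | forall x y, '[A x, y] = '[x, A' y] :> R[i]]).
Qed.

End Riesz.

(** * Power series *)

Section PowerSeries.
Context {R : realType} {V : hilbertType R}.
Implicit Types (a b : nat -> V) (f g : @disc R -> V).

Lemma eventually_bounded (x : nat -> R) (M : R) N :
  (forall n, (N <= n)%N -> x n <= M) -> exists M', forall n, x n <= M'.
Proof.
move=> xM; exists (\sum_(0 <= k < N) `|x k| + `|M|) => n.
case: (leqP N n) => Nn.
  by rewrite (le_trans (xM n Nn))// (le_trans (ler_norm _))// lerDr sumr_ge0.
apply: le_trans (ler_norm _) _; rewrite (bigD1_seq n) /= ?mem_index_iota ?iota_uniq//.
by rewrite -addrA lerDl addr_ge0// sumr_ge0.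
Qed.

Lemma series_term_bounded (v : nat -> V) (l : V) : series v @ \oo --> l ->
  exists M, forall n, nm (v n) <= M.
Proof.
move=> /hcvgP/(_ 1 ltr01)[N vN]; apply: (@eventually_bounded _ 2 N) => n Nn.
have -> : v n = (series v n.+1 - l) - (series v n - l).
  by rewrite /series /= big_nat_recr//= opprB addrA subrK [X in X - _]addrC addrK.
have := vN n Nn; have := vN n.+1 (leqW Nn).
have := nmD (series v n.+1 - l) (- (series v n - l)); rewrite nmN; lra.
Qed.

Lemma disc_cmod (z : disc) : cmod (sval z) < 1 :> R.
Proof. by case: z => z /= ; rewrite cmodE -ltcR. Qed.

Lemma real_disc (t : R) : 0 <= t < 1 -> `|t%:C| < 1 :> R[i].
Proof. by move=> /andP[t0 t1]; rewrite cmodE cmod_real// ltcR. Qed.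

(** Convergence at [1/2] gives [nm (a k) <= M * 2 ^+ k]. For [0 < t <= 1/4] the series at [t]
    without its leading term has ratio [2 * t <= 1/2] and size at most [4 * M * t]; its sum is
    [- a 0], and [t] is arbitrarily small. *)
Lemma power_expansion_lead0 a :
    (forall z : @disc R, sval z != 0 -> series (fun k => sval z ^+ k *: a k) @ \oo --> (0 : V)) ->
  a 0%N = 0.
Proof.
move=> a_cvg.
have tC (t : R) : 0 < t < 1 -> series (fun k => t%:C ^+ k *: a k) @ \oo --> (0 : V).
  move=> /andP[t0 t1]; have t01 : 0 <= t < 1 by rewrite ltW.
  by apply: (a_cvg (exist _ t%:C (real_disc t01))); rewrite /= gt_eqF// ltcR.
have nmt (t : R) k : 0 < t -> nm (t%:C ^+ k *: a k) = t ^+ k * nm (a k).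
  by move=> t0; rewrite nmZ cmodX cmod_real// ltW.
have h2 : 0 < (2^-1 : R) < 1 by lra.
have [M aM] := series_term_bounded (tC _ h2).
have aM' k : nm (a k) <= M * 2 ^+ k.
  by have := aM k; rewrite nmt// exprVn mulrC ler_pdivrMr// exprn_gt0.
have M0 : 0 <= M by have := aM' 0%N; rewrite expr0 mulr1; apply: le_trans (nm_ge0 _).
have small (t : R) : 0 < t <= 4^-1 -> nm (a 0%N) <= 4 * M * t.
  move=> t01; have t0 : 0 < t by case/andP: t01.
  have q01 : 0 <= 2 * t < 1 by lra.
  have [|l vl lM] := @geometric_series _ _ (fun k => t%:C ^+ k.+1 *: a k.+1) (2 * t * M) _ q01.
    move=> n; rewrite nmt// (le_trans (ler_wpM2l _ (aM' n.+1))) ?exprn_ge0 ?(ltW t0)//.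
    by rewrite exprMn !exprS; lra.
  have t1 : 0 < t < 1 by lra.
  have := series_shift (tC t t1); rewrite /= expr0 scale1r sub0r => vl'.
  rewrite (hcvg_unique vl vl') in lM; have := lM 0%N.
  rewrite /series /= big_geq// sub0r opprK expr0 mulr1 => /le_trans; apply.
  rewrite ler_pdivrMr; last by lra.
  have t4 : 0 <= 1 - 4 * t by lra.
  have := mulr_ge0 (mulr_ge0 (ltW t0) M0) t4; lra.
apply: nm_eq0; apply/eqP; rewrite eq_le nm_ge0 andbT.
apply/ler_addgt0Pr => e e0; rewrite add0r.
pose t := Num.min 4^-1 (e / (4 * M + 1)).
have M1 : 0 < 4 * M + 1 by lra.
have te : t <= e / (4 * M + 1) by rewrite ge_min lexx orbT.
have t0 : 0 < t by rewrite lt_min divr_gt0// andbT; lra.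
have t4 : 0 < t <= 4^-1 by rewrite t0 ge_min lexx.
apply: le_trans (small t t4) _; move: te; rewrite ler_pdivlMr//; nra.
Qed.

(** Once [a 0 = 0], division by [z] exposes the next coefficient. This loses the point 0, so the
    hypothesis is stated for [z != 0] only. *)
Lemma power_expansion_eq0 a :
    (forall z : @disc R, sval z != 0 -> series (fun k => sval z ^+ k *: a k) @ \oo --> (0 : V)) ->
  forall n, a n = 0.
Proof.
move=> a_cvg n; elim: n a a_cvg => [|n IH] a a_cvg; first exact: power_expansion_lead0.
apply: (IH (fun k => a k.+1)) => z z0.
have a0 := power_expansion_lead0 a_cvg.
have := series_shift (a_cvg z z0); rewrite a0 scaler0 subr0.
have -> : (fun k => sval z ^+ k.+1 *: a k.+1) = sval z *: (fun k => sval z ^+ k *: a k.+1).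
  by apply/funext => k; rewrite fctE scalerA exprS.
rewrite seriesZ => h.
have -> : series (fun k => sval z ^+ k *: a k.+1) =
   (sval z)^-1 *: (sval z *: series (fun k => sval z ^+ k *: a k.+1)).
  by rewrite scalerA mulVf// scale1r.
by rewrite -(scaler0 _ (sval z)^-1); apply: cvgZ h; exact: cvg_cst.
Qed.

Lemma power_expansion_linear (c : R[i]) f g a b :
  power_expansion f a -> power_expansion g b ->
  power_expansion (c *: f + g) (c *: a + b).
Proof.
move=> fa gb z; have := series_linear (a := c) (fa z) (gb z).
suff -> : c *: (fun k => sval z ^+ k *: a k) + (fun k => sval z ^+ k *: b k) =
    (fun k => sval z ^+ k *: (c *: a + b) k) by [].
by apply/funext => k; rewrite !fctE scalerDr !scalerA mulrC.
Qed.

Lemma power_expansion_inj f a b :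
  power_expansion f a -> power_expansion f b -> a = b.
Proof.
move=> fa fb; apply/funext => n; apply/eqP; rewrite -subr_eq0.
have /power_expansion_eq0 : forall z : @disc R, sval z != 0 ->
    series (fun k => sval z ^+ k *: (a - b) k) @ \oo --> (0 : V).
  move=> z _; have /(_ z) := power_expansion_linear (c := -1) fb fa.
  by rewrite !scaleN1r addNr [- b + a]addrC.
by move=> /(_ n) /eqP.
Qed.

Lemma coefficientsE f a : power_expansion f a -> coefficients f = a.
Proof.
move=> fa; apply: (power_expansion_inj _ fa).
exact: (@xgetPex _ 0 [set a | power_expansion f a]) (ex_intro _ a fa).
Qed.

End PowerSeries.

Arguments power_expansion_linear {R V} c {f g a b} _ _ z _ _.

Lemma complex_cvg (R : realType) (x y : nat -> R) (s t : R) :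
  x @ \oo --> s -> y @ \oo --> t ->
  (fun n => x n +i* y n : R[i]^o) @ \oo --> (s +i* t : R[i]^o).
Proof.
move=> /cvgrPdist_lt xs /cvgrPdist_lt yt; apply/cvgrPdist_lt => -[e e'].
rewrite ltcE /= => /andP[/eqP -> e0].
have e2 : 0 < e / 2 by rewrite divr_gt0.
near=> n.
have xn : `|s - x n| < e / 2 by near: n; exact: xs.
have yn : `|t - y n| < e / 2 by near: n; exact: yt.
rewrite cmodE ltcR /cmod /csq /=.
rewrite -(ger0_norm (ltW e0)) -sqrtr_sqr ltr_sqrt ?exprn_gt0//.
rewrite -(real_normK (num_real (s - x n))) -(real_normK (num_real (t - y n))).
have := normr_ge0 (s - x n); have := normr_ge0 (t - y n); nra.
Unshelve. all: by end_near. Qed.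

(** * Weighted square-summable sequences *)

Section SquareSummable.
Context {R : realType} {V : hilbertType R}.
Variable w : nat -> R.
Hypothesis w_gt0 : forall k, 0 < w k.
Implicit Types (a b c : nat -> V) (S : set V).

Definition wsum a N : R := \sum_(0 <= k < N) w k * nsq (a k).

Definition sqsum a : Prop := exists M, forall N, wsum a N <= M.

(** Sequence analogue of [rdot]; [ell2w_ipE] recovers the complex scalar product from its values at
    [b] and ['i *: b]. *)
Definition rwip a b : R := lim (series (fun k => w k * rdot (a k) (b k)) @ \oo).

Lemma wsum_ge0 a N : 0 <= wsum a N.
Proof. by apply: sumr_ge0 => k _; rewrite mulr_ge0 ?nsq_ge0 ?ltW. Qed.

Lemma wsum_le a N M : (N <= M)%N -> wsum a N <= wsum a M.
Proof.
move=> NM; rewrite /wsum (@big_cat_nat _ _ _ N 0 M)//= lerDl.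
by apply: sumr_ge0 => k _; rewrite mulr_ge0 ?nsq_ge0 ?ltW.
Qed.

Lemma ell2w_setE S a : ell2w_set w S a <-> (forall k, S (a k)) /\ sqsum a.
Proof.
have t0 (n : nat) : (0 <= n)%N -> true ->
    (0%R <= (w n * complex.Re '[a n, a n])%:E)%E.
  by move=> _ _; rewrite lee_fin mulr_ge0 ?nsq_ge0 ?ltW.
split=> -[Sa]; last first.
  move=> [M aM]; split=> //; apply: (@le_lt_trans _ _ M%:E); last exact: ltry.
  apply: lime_le; first exact: is_cvg_nneseries.
  by apply: nearW => n; rewrite sumEFin lee_fin; exact: aM.
move=> alt; split=> //.
have afin : (\sum_(0 <= k <oo) (w k * complex.Re '[a k, a k])%:E)%E \is a fin_num.
  by rewrite ge0_fin_numE// nneseries_ge0.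
exists (fine (\sum_(0 <= k <oo) (w k * complex.Re '[a k, a k])%:E)%E) => N.
rewrite -lee_fin fineK// /wsum -sumEFin.
exact: nneseries_lim_ge.
Qed.

Lemma sqsumD a b : sqsum a -> sqsum b -> sqsum (a + b).
Proof.
move=> [M aM] [M' bM]; exists (2 * (M + M')) => N.
apply: (@le_trans _ _ (2 * (wsum a N + wsum b N))).
  rewrite /wsum -big_split /= mulr_sumr; apply: ler_sum => k _.
  by rewrite -mulrDr mulrCA ler_wpM2l ?nsqD_le// ltW.
by rewrite ler_wpM2l// lerD.
Qed.

Lemma wsumZ x a N : wsum (x *: a) N = csq x * wsum a N.
Proof.
rewrite /wsum mulr_sumr; apply: eq_bigr => k _.
by rewrite fctE nsqZ mulrCA.
Qed.

Lemma sqsumZ x a : sqsum a -> sqsum (x *: a).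
Proof.
move=> [M aM]; exists (csq x * M) => N.
by rewrite wsumZ ler_wpM2l ?csq_ge0.
Qed.

Lemma sqsumN a : sqsum a -> sqsum (- a).
Proof. by move=> /(sqsumZ (-1)); rewrite scaleN1r. Qed.

Lemma wsum_cvg a : sqsum a -> wsum a @ \oo --> rwip a a.
Proof.
move=> [M aM].
suff : cvgn (wsum a) by [].
apply: nondecreasing_is_cvgn; first by move=> N N' ?; exact: wsum_le.
by exists M => _ [N _ <-].
Qed.

(** Polarisation reduces the mixed series to two monotone bounded ones. *)
Lemma rwip_cvg a b : sqsum a -> sqsum b ->
  series (fun k => w k * rdot (a k) (b k)) @ \oo --> rwip a b.
Proof.
move=> sa sb.
rewrite /rwip.
have h : (fun N => 4^-1 * (wsum (a + b) N - wsum (a - b) N)) @ \oo -->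
   4^-1 * (rwip (a + b) (a + b) - rwip (a - b) (a - b)).
  apply: cvgM; first exact: cvg_cst.
  by apply: cvgB; apply: wsum_cvg; [exact: sqsumD|exact/sqsumD/sqsumN].
suff -> : series (fun k => w k * rdot (a k) (b k)) =
   (fun N => 4^-1 * (wsum (a + b) N - wsum (a - b) N)) by apply/cvg_ex; eexists; exact: h.
apply/funext => N; rewrite /series /wsum /= -sumrB mulr_sumr.
by apply: eq_bigr => k _; rewrite rdot_polar !fctE; lra.
Qed.

Lemma rwipE a b (l : R) :
  series (fun k => w k * rdot (a k) (b k)) @ \oo --> l -> rwip a b = l.
Proof. exact: cvg_lim. Qed.

Lemma rwipC a b : rwip a b = rwip b a.
Proof.
by rewrite /rwip; under eq_fun => k do rewrite rdotC.
Qed.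

Lemma rwipDl a b c : sqsum a -> sqsum b -> sqsum c ->
  rwip (a + b) c = rwip a c + rwip b c.
Proof.
move=> sa sb sc; apply: rwipE.
have -> : series (fun k => w k * rdot ((a + b) k) (c k)) =
    series (fun k => w k * rdot (a k) (c k)) + series (fun k => w k * rdot (b k) (c k)).
  apply/funext => N; rewrite /series /= !fctE -big_split /=.
  by apply: eq_bigr => k _; rewrite ?fctE rdotDl mulrDr.
by apply: cvgD; exact: rwip_cvg.
Qed.

Lemma rwipDr a b c : sqsum a -> sqsum b -> sqsum c ->
  rwip c (a + b) = rwip c a + rwip c b.
Proof. by move=> *; rewrite rwipC rwipDl// !(rwipC c). Qed.

Lemma rwipZl (t : R) a b : sqsum a -> sqsum b -> rwip (t%:C *: a) b = t * rwip a b.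
Proof.
move=> sa sb; apply: rwipE.
have -> : series (fun k => w k * rdot ((t%:C *: a) k) (b k)) =
    cst t * series (fun k => w k * rdot (a k) (b k)).
  apply/funext => N; rewrite /series /= fctE mulr_sumr.
  by apply: eq_bigr => k _; rewrite fctE rdotZl mulrCA.
by apply: cvgM; [exact: cvg_cst|exact: rwip_cvg].
Qed.

Lemma rwipNl a b : sqsum a -> sqsum b -> rwip (- a) b = - rwip a b.
Proof.
move=> sa sb; have := rwipZl (-1) sa sb.
by rewrite rmorphN1 scaleN1r mulN1r.
Qed.

Lemma rwip_norm_le a M : (forall N, wsum a N <= M) -> rwip a a <= M.
Proof.
move=> aM; apply: (cvgr_to_le (wsum_cvg (ex_intro _ M aM))).
exact: nearW.
Qed.

Lemma wsum_le_rwip a N : sqsum a -> wsum a N <= rwip a a.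
Proof.
move=> sa; apply: (cvgr_to_ge (wsum_cvg sa)).
by exists N => // M /= NM; exact: wsum_le.
Qed.

Lemma rwip_ge0 a : sqsum a -> 0 <= rwip a a.
Proof. by move=> sa; apply: le_trans (wsum_le_rwip 0 sa); exact: wsum_ge0. Qed.

Lemma rwipDD a b : sqsum a -> sqsum b ->
  rwip (a + b) (a + b) = rwip a a + 2 * rwip a b + rwip b b.
Proof.
move=> sa sb; have sab := sqsumD sa sb.
by rewrite rwipDl// !rwipDr// (rwipC b a); ring.
Qed.

Lemma ell2w_ipE a b : sqsum a -> sqsum b ->
  ell2w_ip w a b = rwip a b +i* rwip a ('i *: b).
Proof.
move=> sa sb; rewrite /ell2w_ip; apply: (@cvg_lim R[i]^o) => //.
have := complex_cvg (rwip_cvg sa sb) (rwip_cvg sa (sqsumZ 'i sb)).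
suff -> : (fun n => series (fun k => w k * rdot (a k) (b k)) n +i*
    series (fun k => w k * rdot (a k) (('i *: b) k)) n) =
  series (fun k => (w k)%:C * '[a k, b k] : R[i]^o) by [].
apply/funext => N; rewrite /series /=; apply: complex_eq => /=.
  by rewrite Re_sum; apply: eq_bigr => k _; rewrite ReM_real.
by rewrite Im_sum; apply: eq_bigr => k _; rewrite ImM_real Im_hdot.
Qed.

Lemma rwip_i a : sqsum a -> rwip a ('i *: a) = 0.
Proof.
move=> sa; apply: rwipE.
have -> : (fun k => w k * rdot (a k) (('i *: a) k)) = fun=> 0.
  by apply/funext => k; rewrite fctE -Im_hdot hdot_nsq /= mulr0.
have -> : series (fun=> 0 : R) = fun=> 0.
  by apply/funext => N; rewrite /series /= big1.
exact: cvg_cst.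
Qed.

Lemma ell2w_ip_norm a : sqsum a -> ell2w_ip w a a = (rwip a a)%:C.
Proof. by move=> sa; rewrite ell2w_ipE// rwip_i. Qed.

End SquareSummable.

(** * Growth of the inverse weights *)

Section WeightGrowth.
Context {R : realType} (w : nat -> R).
Hypothesis hw : weight_sequence w.

(** As [r] lies below the lower limit 1 of the [k]-th roots of [w k], eventually [r ^+ k < w k]; the
    constant [K] absorbs the finitely many other indices. *)
Lemma weight_growth (r : R) : 0 < r < 1 ->
  exists K, forall k, (w k)^-1 * r ^+ k <= K.
Proof.
move=> /andP[r0 r1]; case: hw => -[w0 w_gt0 w_dec einf1] _ _ _.
set u : nat -> \bar R := fun k => (w k `^ (k%:R)^-1)%:E.
have : (r%:E < ereal_sup (range (einfs u)))%E.
  suff -> : ereal_sup (range (einfs u)) = 1%:E by rewrite lte_fin.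
  rewrite -einf1 limn_einf_lim; apply/esym/cvg_lim => //.
  exact: cvg_einfs_sup.
move=> /ereal_sup_gt[_ [N _ <-] rN].
(* Starting at [N.+1] rules out [k = 0], where the root has no meaning. *)
apply: (@eventually_bounded _ _ 1 N.+1) => k Nk.
have k0 : (0 < k)%N by apply: leq_ltn_trans Nk.
have : (r%:E < u k)%E.
  apply: (lt_le_trans rN); apply: ereal_inf_lbound.
  by exists k => //=; exact: ltnW.
rewrite lte_fin => rk.
rewrite ler_pdivrMl// mulr1.
have -> : w k = (w k `^ (k%:R)^-1) ^+ k.
  rewrite -powR_mulrn ?powR_ge0// -powRrM mulVf ?pnatr_eq0 -?lt0n//.
  by rewrite powRr1// ltW.
by rewrite lerXn2r ?nnegrE ?powR_ge0// ltW.
Qed.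

(** Some of the room between [p] and 1 absorbs the growth of [1 / w k]. The strict gap [p < q] is
    kept because the product estimate [cauchy_product_error] divides by it. *)
Lemma weight_power (p : R) : 0 <= p < 1 ->
  exists K q, [/\ 0 <= K, p < q, q < 1 & forall k, (w k)^-1 * p ^+ k <= K * q ^+ k].
Proof.
move=> /andP[p0 p1]; pose r := (1 + p) / 2.
have r01 : 0 < r < 1 by rewrite /r; lra.
have [r0 r1] := andP r01.
have [K wK] := weight_growth r01.
have pr : p / r < 1 by rewrite ltr_pdivrMr// mul1r /r; lra.
have ppr : p <= p / r by rewrite ler_pdivlMr// ler_piMr// ltW.
have wk k : 0 < (w k)^-1 by rewrite invr_gt0; case: hw => -[].
exists K, ((p / r + 1) / 2); split; [|lra|lra|move=> k].
  by apply: le_trans (wK 0%N); rewrite mulr1 ltW.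
set q := (p / r + 1) / 2.
have q0 : 0 <= q by rewrite /q; lra.
apply: le_trans (ler_wpM2r (exprn_ge0 k q0) (wK k)).
have pq : p <= q * r by rewrite -ler_pdivrMr// /q; lra.
have qr0 : 0 <= q * r by rewrite mulr_ge0// ltW.
by rewrite -mulrA -exprMn ler_pM2l// mulrC lerXn2r.
Qed.

End WeightGrowth.

(** * Linear maps, limits of squared norms and of finite sums *)

Definition islin {R : realType} {V W : lmodType R[i]} (F : V -> W) : Prop :=
  forall (a : R[i]) x y, F (a *: x + y) = a *: F x + F y.

Section Linear.
Context {R : realType} {V W : lmodType R[i]} (F : V -> W).
Hypothesis linF : islin F.

Lemma islin0 : F 0 = 0.
Proof.
have := linF 1 0 0; rewrite !scale1r addr0 => /eqP.
by rewrite -subr_eq subrr eq_sym => /eqP.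
Qed.

Lemma islinD x y : F (x + y) = F x + F y.
Proof. by have := linF 1 x y; rewrite !scale1r. Qed.

Lemma islinZ a x : F (a *: x) = a *: F x.
Proof. by have := linF a x 0; rewrite islin0 !addr0. Qed.

Lemma islinN x : F (- x) = - F x.
Proof. by rewrite -scaleN1r islinZ scaleN1r. Qed.

Lemma islinB x y : F (x - y) = F x - F y.
Proof. by rewrite islinD islinN. Qed.

Lemma islin_sum (G : nat -> V) n :
  F (\sum_(0 <= k < n) G k) = \sum_(0 <= k < n) F (G k).
Proof.
elim: n => [|n IH]; first by rewrite !big_geq// islin0.
by rewrite !big_nat_recr//= islinD IH.
Qed.

End Linear.

Lemma islin_iter {R : realType} {V : lmodType R[i]} (F : V -> V) n :
  islin F -> islin (iter n F).
Proof. by move=> linF a x y; elim: n => //= n ->. Qed.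

Lemma cvg_nsq (R : realType) (V : hilbertType R) (u : nat -> V) l :
  u @ \oo --> l -> (fun n => nsq (u n)) @ \oo --> nsq l.
Proof.
move=> /hcvgP ul.
have nml : (fun n => nm (u n)) @ \oo --> nm l.
  apply/cvgrPdist_lt => e e0; have [N uN] := ul e e0; exists N => // n /= /uN.
  apply: le_lt_trans; have := nmD (u n - l) l; have := nmD (l - u n) (u n).
  by rewrite !subrK (nmB l) ler_norml; lra.
rewrite -nm2 expr2.
suff -> : (fun n => nsq (u n)) = (fun n => nm (u n)) \* (fun n => nm (u n)) by exact: cvgM.
by apply/funext => n; rewrite -nm2 expr2.
Qed.

Lemma cvg_sum (R : realType) (F : nat -> nat -> R) (l : nat -> R) K :
  (forall k, F k @ \oo --> l k) ->
  (fun N => \sum_(0 <= k < K) F k N) @ \oo --> \sum_(0 <= k < K) l k.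
Proof.
move=> Fl; elim: K => [|K IH].
  by rewrite big_geq//; under eq_fun do rewrite big_geq//; exact: cvg_cst.
rewrite big_nat_recr//=; under eq_fun do rewrite big_nat_recr//=.
exact: cvgD.
Qed.

Lemma cvg_of_increments (R : realType) (V : hilbertType R) (v : nat -> V) (s : nat -> R) (l : R) :
    s @ \oo --> l ->
    (forall N M, (N <= M)%N -> nsq (v M - v N) <= s M - s N) ->
  exists l' : V, v @ \oo --> l'.
Proof.
move=> /cvgrPdist_lt sl vs; apply: hcauchy => e e0.
have e2 : 0 < e ^+ 2 / 2 by rewrite divr_gt0// exprn_gt0.
have [N0 _ hN] := sl _ e2; exists N0 => N M N0N NM.
have := hN N N0N; have := hN M (leq_trans N0N NM) => /=.
rewrite !ltr_norml => /andP[h1 h2] /andP[h3 h4].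
rewrite -(@ltr_pXn2r _ 2) ?nnegrE ?nm_ge0 ?(ltW e0)// nm2.
have := vs N M NM; lra.
Qed.

(** * The unitary colligation *)

Section Colligation.
Context {R : realType} {H E : hilbertType R}.
Variable w : nat -> R.
Variables (Ts D0 : H -> H) (B : E -> H) (D : E -> nat -> H) (S : set H).

(* [Ts], [D0] and [output h x] stand for [T^*], [D_{w,T}] and [C h + D x]. *)
Definition output h x : nat -> H :=
  fun n => (Num.sqrt (rho w n))%:C *: D0 (iter n Ts h) + D x n.

(** What the argument uses of the triple, with the operators abstract and [S] in the role of the
    defect space. The two operators obtained by choice thus enter only through these properties. *)
Record colligation : Prop := {
  col_weight : weight_sequence w;
  col_linT : islin Ts;
  col_linD0 : islin D0;
  col_linB : islin B;
  col_linD : forall n, islin (D^~ n);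
  out_sqsum : forall h x, sqsum (fun=> 1) (output h x);
  out_isometry : forall h x,
    nsq (Ts h + B x) + rwip (fun=> 1) (output h x) (output h x) = nsq h + nsq x;
  out_surj : forall h' y, (forall n, S (y n)) -> sqsum (fun=> 1) y ->
    exists h x, Ts h + B x = h' /\ output h x = y;
  col_pure : forall h, (fun n => iter n Ts h) @ \oo --> (0 : H);
  col_Slin : forall (a : R[i]) x y, S x -> S y -> S (a *: x + y);
  col_Sclosed : closed S;
  col_SD0 : forall h, S (D0 h);
  col_SD : forall x n, S (D x n)
}.

Hypothesis col : colligation.

Let w0 : w 0%N = 1. Proof. by case: (col_weight col) => -[]. Qed.
Let w_gt0 k : 0 < w k. Proof. by case: (col_weight col) => -[]. Qed.
Let w_dec k : w k.+1 <= w k. Proof. by case: (col_weight col) => -[]. Qed.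
Let one_gt0 (k : nat) : 0 < (1 : R). Proof. exact: ltr01. Qed.
Let linT := col_linT col.
Let linD0 := col_linD0 col.
Let linB := col_linB col.
Let linD := col_linD col.
Let pureT := col_pure col.

Lemma col_S0 : S 0.
Proof. by rewrite -(islin0 linD0); exact: col_SD0. Qed.

Lemma col_SZ (a : R[i]) x : S x -> S (a *: x).
Proof. by move=> Sx; rewrite -[_ *: _]addr0; apply: col_Slin => //; exact: col_S0. Qed.

Lemma col_SDa x y : S x -> S y -> S (x + y).
Proof. by move=> Sx Sy; rewrite -(scale1r x); apply: col_Slin. Qed.

Let SZ := col_SZ.

(* [theta_coef n] is the n-th Taylor coefficient of theta, and [theta_conv x] and [pi_coef h]
   are the coefficient sequences of [theta x] and [pi h]. *)
Definition theta_coef n x : H := (Num.sqrt (rho w n))%:C *: D x n +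
  (if n is m.+1 then (w m)^-1%:C *: D0 (iter m Ts (B x)) else 0).

Definition theta_conv (x : nat -> E) n : H := \sum_(0 <= j < n.+1) theta_coef (n - j) (x j).

Definition pi_coef h n : H := (w n)^-1%:C *: D0 (iter n Ts h).

Definition joint_coef h x n : H := pi_coef h n + theta_conv x n.

Lemma rho_ge0 n : 0 <= rho w n.
Proof. by case: n => //= n; rewrite subr_ge0 lef_pV2 ?posrE. Qed.

Lemma sqrt_rho n : Num.sqrt (rho w n) ^+ 2 = rho w n.
Proof. by rewrite sqr_sqrtr ?rho_ge0. Qed.

Lemma scale_sqrt_rho n (y : H) :
  (Num.sqrt (rho w n))%:C *: ((Num.sqrt (rho w n))%:C *: y) = (rho w n)%:C *: y.
Proof. by rewrite scalerA -rmorphM /= -expr2 sqrt_rho. Qed.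

Lemma scale_rhoS n (y : H) :
  (rho w n.+1)%:C *: y + (w n)^-1%:C *: y = (w n.+1)^-1%:C *: y.
Proof. by rewrite -scalerDl -rmorphD /= subrK. Qed.

Lemma out_lin a h h' x x' n :
  output (a *: h + h') (a *: x + x') n = a *: output h x n + output h' x' n.
Proof.
rewrite /output (islin_iter n linT) linD0 (linD n) !scalerDr !scalerA (mulrC _ a).
by rewrite addrACA.
Qed.

Lemma out0 n : output 0 0 n = 0.
Proof. by rewrite /output (islin0 (islin_iter n linT)) (islin0 linD0) (islin0 (linD n)) scaler0 addr0. Qed.

Lemma gen0 h x : joint_coef h x 0%N = output h (x 0%N) 0%N.
Proof.
rewrite /joint_coef /pi_coef /theta_conv /output /theta_coef big_nat1 /= w0 invr1 sqrtr1 !scale1r.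
by rewrite addr0.
Qed.

(** In [theta_coef n.+1 (x 0)] the [D] part belongs to the present output and the [B] part to the
    next state. The two multiples of [D0 (iter n.+1 Ts h)] combine by
    [rho n.+1 + 1 / w n = 1 / w n.+1]. *)
Lemma genS h x n : joint_coef h x n.+1 =
  (Num.sqrt (rho w n.+1))%:C *: output h (x 0%N) n.+1 +
  joint_coef (Ts h + B (x 0%N)) (fun k => x k.+1) n.
Proof.
rewrite /joint_coef /pi_coef /theta_conv big_nat_recl// subn0.
under eq_bigr => j _ do rewrite subSS.
rewrite addrA [RHS]addrA; congr (_ + _).
rewrite /theta_coef /output (islinD (islin_iter n linT)) (islinD linD0) -iterSr.
rewrite !scalerDr !addrA; congr (_ + _).
by rewrite scale_sqrt_rho addrAC scale_rhoS.
Qed.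

Lemma gen_lin a h h' (x x' : nat -> E) n :
  joint_coef (a *: h + h') (a *: x + x') n = a *: joint_coef h x n + joint_coef h' x' n.
Proof.
elim: n h h' x x' => [|n IH] h h' x x'; first by rewrite !gen0 out_lin.
rewrite !genS out_lin.
have -> : joint_coef (Ts (a *: h + h') + B ((a *: x + x') 0%N)) (fun k => (a *: x + x') k.+1) n =
    a *: joint_coef (Ts h + B (x 0%N)) (fun k => x k.+1) n +
    joint_coef (Ts h' + B (x' 0%N)) (fun k => x' k.+1) n.
  by rewrite -IH linT (linB a) scalerDr addrACA.
move: (output h _ _) (output h' _ _) (joint_coef _ _ n) (joint_coef _ _ n) => o o' g g'.
by rewrite !scalerDr !scalerA (mulrC a) addrACA.
Qed.

Lemma wsumS (v : nat -> R) (a : nat -> H) N :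
  wsum v a N.+1 = v 0%N * nsq (a 0%N) + wsum (fun n => v n.+1) (fun n => a n.+1) N.
Proof. by rewrite /wsum big_nat_recl. Qed.

(** Cauchy-Schwarz for the coefficients [s = sqrt (rho n.+1)] and 1. After division by [w n.+1] the
    two sides differ by [nsq (s * w n *: z - y) / w n], so equality holds exactly when
    [y = s * w n *: z]. *)
Lemma weighted_sq_le n (y z : H) :
  w n.+1 * nsq ((Num.sqrt (rho w n.+1))%:C *: y + z) <= nsq y + w n * nsq z.
Proof.
rewrite mulrC -ler_pdivlMr//.
have -> : (w n.+1)^-1 = Num.sqrt (rho w n.+1) ^+ 2 + (w n)^-1 by rewrite sqrt_rho /= subrK.
set s := Num.sqrt _; rewrite nsqD nsqZr rdotZl.
have := nsq_ge0 ((s * w n)%:C *: z - y); rewrite nsqB nsqZr rdotZl (rdotC z).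
have wn := w_gt0 n; have := wn; rewrite -invr_gt0 => /ltW wV h.
have := mulr_ge0 wV h.
have -> : (w n)^-1 * ((s * w n) ^+ 2 * nsq z - 2 * (s * w n * rdot y z) + nsq y) =
  s ^+ 2 * w n * nsq z - 2 * (s * rdot y z) + nsq y * (w n)^-1.
  by field; rewrite gt_eqF.
have -> : (nsq y + w n * nsq z) * (s ^+ 2 + (w n)^-1) =
   s ^+ 2 * nsq y + s ^+ 2 * w n * nsq z + nsq y * (w n)^-1 + nsq z.
  by field; rewrite gt_eqF.
lra.
Qed.

(** The induction generalises over [h] and [x]: after one step the run restarts from
    [Ts h + B (x 0)] with shifted inputs, and [out_isometry] balances the energy of that step. *)
Lemma gen_contraction h x N :
  wsum w (joint_coef h x) N <= nsq h + \sum_(0 <= k < N) nsq (x k).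
Proof.
elim: N h x => [|N IH] h x; first by rewrite /wsum !big_geq// addr0 nsq_ge0.
rewrite wsumS w0 mul1r gen0 big_nat_recl//.
have := IH (Ts h + B (x 0%N)) (fun k => x k.+1).
have := out_isometry col h (x 0%N).
have := wsum_le_rwip one_gt0 N.+1 (out_sqsum col h (x 0%N)).
rewrite wsumS mul1r.
have : wsum (fun n => w n.+1) (fun n => joint_coef h x n.+1) N <=
  wsum (fun=> 1) (fun n => output h (x 0%N) n.+1) N +
  wsum w (joint_coef (Ts h + B (x 0%N)) (fun k => x k.+1)) N.
  rewrite /wsum -big_split /=; apply: ler_sum => n _.
  by rewrite genS mul1r weighted_sq_le.
lra.
Qed.

Lemma thc0 n : theta_conv 0 n = 0.
Proof.
rewrite /theta_conv big1// => j _; rewrite /theta_coef (islin0 (linD _)) scaler0 add0r.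
case: (n - j)%N => // m.
by rewrite (islin0 linB) (islin0 (islin_iter m linT)) (islin0 linD0) scaler0.
Qed.

Lemma gen_pic h : joint_coef h 0 = pi_coef h.
Proof. by apply/funext => n; rewrite /joint_coef thc0 addr0. Qed.

Lemma gen_thc x : joint_coef 0 x = theta_conv x.
Proof.
apply/funext => n; rewrite /joint_coef /pi_coef (islin0 (islin_iter n linT)).
by rewrite (islin0 linD0) scaler0 add0r.
Qed.

Lemma pic_contraction h N : wsum w (pi_coef h) N <= nsq h.
Proof.
rewrite -gen_pic (le_trans (gen_contraction _ _ _))// big1 ?addr0//.
by move=> k _; rewrite nsq0.
Qed.

Lemma pic_sqsum h : sqsum w (pi_coef h).
Proof. by exists (nsq h) => N; exact: pic_contraction. Qed.

Lemma nsq_pic h n : w n * nsq (pi_coef h n) = (w n)^-1 * nsq (D0 (iter n Ts h)).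
Proof. by rewrite nsqZr; field; rewrite gt_eqF. Qed.

(* [|C h|^2], computed from [1 / w n - 1 / w (n-1) = rho n] by Abel summation. *)
Lemma pic_defect h : rwip w (pi_coef h) (pi_coef h) - rwip w (pi_coef (Ts h)) (pi_coef (Ts h)) =
  nsq h - nsq (Ts h).
Proof.
have -> : nsq h - nsq (Ts h) = rwip (fun=> 1) (output h 0) (output h 0).
  by have := out_isometry col h 0; rewrite (islin0 linB) nsq0 !addr0 => <-; rewrite addrAC subrr add0r.
apply/esym/(@rwipE R H (fun=> 1)); rewrite -(cvg_shiftS (series _)).
(* The first [N + 1] terms of the output match [N + 1] terms for [h] but only [N] terms for
   [Ts h]. *)
have -> : (fun n => series (fun k => 1 * rdot (output h 0 k) (output h 0 k)) n.+1) =
   (fun n => wsum w (pi_coef h) n.+1 - wsum w (pi_coef (Ts h)) n).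
  apply/funext => N; rewrite /series /= wsumS big_nat_recl//= /wsum -addrA -sumrB.
  congr (_ + _); first by rewrite mul1r w0 mul1r -gen_pic gen0.
  apply: eq_bigr => n _; rewrite mul1r -[LHS]/(nsq _) !nsq_pic -iterSr /=.
  rewrite /output (islin0 (linD _)) addr0 nsqZr sqrt_rho /=; ring.
apply: cvgB; last exact/wsum_cvg/pic_sqsum.
by rewrite (cvg_shiftS (wsum w (pi_coef h))); exact/wsum_cvg/pic_sqsum.
Qed.

(** By [pic_defect] the deficit [nsq h - rwip w (pi_coef h) (pi_coef h)] is the same for [h] and
    every [iter n Ts h]. It is nonnegative and at most [nsq (iter n Ts h)], which tends to 0. *)
Lemma pic_isometry h : rwip w (pi_coef h) (pi_coef h) = nsq h.
Proof.
have q_le k : rwip w (pi_coef k) (pi_coef k) <= nsq k by exact/rwip_norm_le/pic_contraction.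
have tele n : nsq h - rwip w (pi_coef h) (pi_coef h) =
    nsq (iter n Ts h) - rwip w (pi_coef (iter n Ts h)) (pi_coef (iter n Ts h)).
  elim: n => //= n ->; have := pic_defect (iter n Ts h); lra.
apply/eqP; rewrite eq_le q_le /= -subr_le0.
have := cvg_nsq (pureT h); rewrite nsq0 => /cvgr_to_ge; apply.
apply: nearW => n; rewrite (tele n) lerBlDr lerDl.
exact/rwip_ge0/pic_sqsum.
Qed.

Lemma pic_lin a h h' : pi_coef (a *: h + h') = a *: pi_coef h + pi_coef h'.
Proof.
apply/funext => n; have := gen_lin a h h' 0 0 n.
by rewrite scaler0 addr0 !gen_pic.
Qed.

Lemma thc_lin a x x' : theta_conv (a *: x + x') = a *: theta_conv x + theta_conv x'.
Proof.
apply/funext => n; have := gen_lin a 0 0 x x' n.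
by rewrite scaler0 addr0 !gen_thc.
Qed.

Lemma pic_rwip h k : rwip w (pi_coef h) (pi_coef k) = rdot h k.
Proof.
have := pic_isometry (h + k); rewrite -(scale1r h) pic_lin !scale1r.
rewrite rwipDD ?pic_isometry ?nsqD; [lra|exact: w_gt0|exact: pic_sqsum..].
Qed.

(* Runs of the system whose output at time [k] is [sqrt (rho n) * u (n + k)]: up to the
   weights, the adjoint of the summation along antidiagonals. *)
Definition trajectory (u : nat -> H) (hs : nat -> H) (x : nat -> E) : Prop :=
  forall k, Ts (hs k) + B (x k) = hs k.+1 /\
    forall n, output (hs k) (x k) n = (Num.sqrt (rho w n))%:C *: u (n + k)%N.

Lemma trajectory_shift u hs x : trajectory u hs x ->
  trajectory (fun n => u n.+1) (fun n => hs n.+1) (fun n => x n.+1).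
Proof. by move=> tr k; have [h1 h2] := tr k.+1; split=> // n; rewrite h2 addnS. Qed.

Lemma trajectoryB u hs x u' hs' x' : trajectory u hs x -> trajectory u' hs' x' ->
  trajectory (u - u') (hs - hs') (x - x').
Proof.
move=> t t' k; have [h1 h2] := t k; have [h1' h2'] := t' k.
rewrite !fctE; split.
  by rewrite (islinB linT) (islinB linB) -h1 -h1' opprD addrACA.
move=> n; have := out_lin (-1) (hs' k) (hs k) (x' k) (x k) n.
by rewrite !scaleN1r !(addrC (- _)) => ->; rewrite h2 h2' -scalerBr.
Qed.

(** The factor [sqrt (rho j)] occurs twice, in the output and in the antidiagonal sum; all terms of
    coefficient [n] are multiples of [u n], and [rho 0 + ... + rho n = 1 / w n]. *)
Lemma trajectory_gen u hs x n : trajectory u hs x ->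
  joint_coef (hs 0%N) x n = (w n)^-1%:C *: u n.
Proof.
elim: n u hs x => [|n IH] u hs x tr; have [h1 h2] := tr 0%N.
  by rewrite gen0 h2 addn0 w0 invr1 sqrtr1.
rewrite genS h1 (IH _ _ _ (trajectory_shift tr)) h2 addn0.
by rewrite scale_sqrt_rho scale_rhoS.
Qed.

Lemma finite_sqsum (y : nat -> H) N : (forall n, (N <= n)%N -> y n = 0) ->
  (forall n, (N <= n)%N -> wsum (fun=> 1) y n = wsum (fun=> 1) y N).
Proof.
move=> y0 n Nn; rewrite /wsum (@big_cat_nat _ _ _ N 0 n)//= [X in _ + X]big_nat_cond.
by rewrite [X in _ + X]big1 ?addr0// => k /andP[/andP[/y0 -> _] _]; rewrite nsq0 mulr0.
Qed.

(** Time runs backwards: the shifted [u] has a run by induction, and [out_surj] supplies a state and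
    an input that lead to its initial state with the prescribed output. After the support of [u]
    everything is 0. *)
Lemma exists_trajectory N u : (forall n, S (u n)) ->
    (forall n, (N <= n)%N -> u n = 0) ->
  exists hs x, trajectory u hs x /\
    forall k, (N <= k)%N -> hs k = 0 /\ x k = 0.
Proof.
elim: N u => [|N IH] u Su u0.
  exists (fun=> 0), (fun=> 0); split=> // k; split=> [|n].
    by rewrite (islin0 linT) (islin0 linB) addr0.
  by rewrite out0 u0// scaler0.
have [n|n Nn|hs' [x' [tr tr0]]] := IH (fun n => u n.+1); [exact: Su|exact: u0|].
pose y n := (Num.sqrt (rho w n))%:C *: u n.
have y0 n : (N.+1 <= n)%N -> y n = 0 by move=> Nn; rewrite /y u0// scaler0.
have [|h [x [h1 h2]]] := out_surj col (hs' 0%N) (y := y) (fun n => SZ _ (Su n)).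
  exists (wsum (fun=> 1) y N.+1) => n.
  have [Nn|/ltnW nN] := leqP N.+1 n; first by rewrite (finite_sqsum y0).
  exact: wsum_le one_gt0 _ _ _ nN.
exists (fun k => if k is k'.+1 then hs' k' else h),
       (fun k => if k is k'.+1 then x' k' else x); split; last by case.
case=> [|k]; first by split=> // n; rewrite h2 addn0.
by have [t1 t2] := tr k; split=> // n; rewrite t2 addnS.
Qed.

(** The equality counterpart of [gen_contraction]: summing [rho n * nsq (u (n + k))] over all steps
    [k] collects the weight [1 / w n] on [nsq (u n)]. *)
Lemma trajectory_energy N u hs x : trajectory u hs x ->
    (forall n, (N <= n)%N -> u n = 0) ->
    (forall k, (N <= k)%N -> hs k = 0 /\ x k = 0) ->
  nsq (hs 0%N) + \sum_(0 <= k < N) nsq (x k) =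
    \sum_(0 <= n < N) (w n)^-1 * nsq (u n).
Proof.
elim: N u hs x => [|N IH] u hs x tr u0 z0.
  by rewrite !big_geq// (z0 0%N _).1// nsq0 addr0.
have e := IH _ _ _ (trajectory_shift tr) (fun n Nn => u0 n.+1 Nn) (fun n Nn => z0 n.+1 Nn).
have [t1 t2] := tr 0%N; have := out_isometry col (hs 0%N) (x 0%N).
have yE n : output (hs 0%N) (x 0%N) n = (Num.sqrt (rho w n))%:C *: u n by rewrite t2 addn0.
have -> : rwip (fun=> 1) (output (hs 0%N) (x 0%N)) (output (hs 0%N) (x 0%N)) =
    \sum_(0 <= n < N.+1) rho w n * nsq (u n).
  have y0 n : (N.+1 <= n)%N -> output (hs 0%N) (x 0%N) n = 0.
    by move=> Nn; rewrite yE u0// scaler0.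
  have -> : \sum_(0 <= n < N.+1) rho w n * nsq (u n) = wsum (fun=> 1) (output (hs 0%N) (x 0%N)) N.+1.
    by apply: eq_bigr => n _; rewrite mul1r yE nsqZr sqrt_rho.
  apply: (@rwipE R H (fun=> 1)); apply: cvg_near_cst.
  by exists N.+1 => // n /= Nn; exact: (finite_sqsum y0).
rewrite t1 big_nat_recl// mul1r => i.
rewrite big_nat_recl// [RHS]big_nat_recl// w0 invr1 mul1r.
have -> : \sum_(0 <= n < N) (w n.+1)^-1 * nsq (u n.+1) =
  \sum_(0 <= n < N) (w n)^-1 * nsq (u n.+1) +
  \sum_(0 <= n < N) rho w n.+1 * nsq (u n.+1).
  by rewrite -big_split /=; apply: eq_bigr => n _; ring.
lra.
Qed.

Lemma genB h h' (x x' : nat -> E) n :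
  joint_coef (h - h') (x - x') n = joint_coef h x n - joint_coef h' x' n.
Proof.
have := gen_lin (-1) h' h x' x n.
by rewrite !scaleN1r !(addrC (- _)).
Qed.

(* Truncating [a] gives finite trajectories, which form a Cauchy sequence because their
   differences are trajectories again and satisfy the energy identity. *)
Lemma gen_onto a : (forall n, S (a n)) -> sqsum w a ->
  exists h x, [/\ sqsum (fun=> 1) x, joint_coef h x = a &
    nsq h + rwip (fun=> 1) x x <= rwip w a a].
Proof.
move=> Sa sa.
(* [trajectory_gen] returns [u n] divided by [w n], hence the factor [w n]. *)
pose u N n := if (n < N)%N then (w n)%:C *: a n else 0.
have u0 N n : (N <= n)%N -> u N n = 0 by rewrite /u leqNgt => /negbTE ->.
have Su N n : S (u N n).
  by rewrite /u; case: ifP => _; [exact: SZ|rewrite -(scale0r (a n)); exact: SZ].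
have /choice[p pP] : forall N, exists p : (nat -> H) * (nat -> E),
    trajectory (u N) p.1 p.2 /\ forall k, (N <= k)%N -> p.1 k = 0 /\ p.2 k = 0.
  by move=> N; have [hs [x hx]] := exists_trajectory (Su N) (@u0 N); exists (hs, x).
pose hN N := (p N).1 0%N; pose xN N := (p N).2.
have energy N M : (N <= M)%N -> nsq (hN M - hN N) +
    \sum_(0 <= k < M) nsq (xN M k - xN N k) = wsum w a M - wsum w a N.
  move=> NM; have [t1 z1] := pP M; have [t2 z2] := pP N.
  have := trajectory_energy (N := M) (trajectoryB t1 t2).
  rewrite !fctE => -> => [|n Mn|k Mk]; last 2 first.
  - by rewrite !u0 ?subr0// (leq_trans NM).
  - have [-> ->] := z1 k Mk; have [-> ->] := z2 k (leq_trans NM Mk).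
    by rewrite !subr0.
  rewrite /wsum (@big_cat_nat _ _ _ N 0 M)//= [in RHS](@big_cat_nat _ _ _ N 0 M)//=.
  rewrite addrAC subrr add0r big_nat_cond big1 ?add0r => [|n /andP[/andP[_ nN] _]].
    rewrite big_nat_cond [RHS]big_nat_cond; apply: eq_bigr => n /andP[/andP[Nn nM] _].
    rewrite ?fctE (u0 N)// subr0 /u nM nsqZr; field; exact: lt0r_neq0.
  by rewrite ?fctE /u nN (leq_trans nN NM) subrr nsq0 mulr0.
have sum_ge0 (x : nat -> E) M : 0 <= \sum_(0 <= k < M) nsq (x k).
  by apply: sumr_ge0 => k _; exact: nsq_ge0.
have [h hN_h] : exists h : H, hN @ \oo --> h.
  apply: (cvg_of_increments (wsum_cvg w_gt0 sa)) => N M NM.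
  by rewrite -energy// lerDl sum_ge0.
have /choice[x xN_x] : forall k, exists x : E, (fun N => xN N k) @ \oo --> x.
  move=> k; apply: (cvg_of_increments (wsum_cvg w_gt0 sa)) => N M NM.
  rewrite -energy//; have [kM|Mk] := ltnP k M; last first.
    have [_ z1] := (pP M).2 k Mk; have [_ z2] := (pP N).2 k (leq_trans NM Mk).
    by rewrite /xN z1 z2 subr0 nsq0 addr_ge0 ?nsq_ge0.
  rewrite (bigD1_seq k) /= ?mem_index_iota ?iota_uniq// addrCA lerDl.
  by rewrite addr_ge0 ?nsq_ge0// sumr_ge0// => *; exact: nsq_ge0.
have norm_le K : nsq h + \sum_(0 <= k < K) nsq (x k) <= rwip w a a.
  have cv : (fun N => nsq (hN N) + \sum_(0 <= k < K) nsq (xN N k)) @ \oo -->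
      nsq h + \sum_(0 <= k < K) nsq (x k).
    apply: cvgD; first exact: cvg_nsq.
    by apply: cvg_sum => k; exact/cvg_nsq/xN_x.
  apply: (cvgr_to_le cv); exists K => // N /= KN.
  apply: le_trans (wsum_le_rwip w_gt0 N sa).
  (* The run for truncation at 0 vanishes identically, so this is the energy of run [N] itself. *)
  have := energy 0%N N (leq0n _).
  have -> : hN 0%N = 0 by have [] := (pP 0%N).2 0%N (leqnn _).
  have x0 k : xN 0%N k = 0 by have [] := (pP 0%N).2 k (leq0n _).
  have -> : \sum_(0 <= k < N) nsq (xN N k - xN 0%N k) = \sum_(0 <= k < N) nsq (xN N k).
    by apply: eq_bigr => k _; rewrite x0 subr0.
  rewrite subr0 [wsum _ _ 0]big_geq// subr0 => <-; rewrite lerD2l.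
  rewrite [leRHS](@big_cat_nat _ _ _ K 0 N)//= lerDl.
  by apply: sumr_ge0 => *; exact: nsq_ge0.
have sx : sqsum (fun=> 1) x.
  exists (rwip w a a) => K; apply: le_trans (norm_le K); rewrite /wsum.
  by under eq_bigr do rewrite mul1r; rewrite lerDr nsq_ge0.
exists h, x; split => //; last first.
  rewrite addrC -lerBrDr; apply: (rwip_norm_le one_gt0) => K; rewrite lerBrDr addrC /wsum.
  by under eq_bigr do rewrite mul1r; exact: norm_le.
apply/funext => n; apply/eqP; rewrite -subr_eq0; apply/eqP/nsq_eq0/eqP.
rewrite eq_le nsq_ge0 andbT -(pmulr_rle0 _ (w_gt0 n)).
(* For [n < N] coefficient [n] of run [N] is exactly [a n]. The error at [n] is thus a coefficient
   of a difference of runs, which [gen_contraction] bounds by this vanishing quantity. *)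
have cv : (fun N => nsq (h - hN N) + \sum_(0 <= k < n.+1) nsq (x k - xN N k)) @ \oo -->
    nsq (h - h) + \sum_(0 <= k < n.+1) nsq (x k - x k).
  apply: cvgD; first by apply: cvg_nsq; apply: cvgB => //; exact: cvg_cst.
  apply: cvg_sum => k; apply: cvg_nsq; apply: cvgB; first exact: cvg_cst.
  exact: xN_x.
have lim0 : nsq (h - h) + \sum_(0 <= k < n.+1) nsq (x k - x k) = 0.
  by rewrite subrr nsq0 add0r big1// => k _; rewrite subrr nsq0.
rewrite -lim0; apply: (cvgr_to_ge cv); exists n.+1 => // N /= nN.
have aE : a n = joint_coef (hN N) (xN N) n.
  rewrite (trajectory_gen n (proj1 (pP N))) /u nN scalerA -rmorphM /= mulVf ?scale1r//.
  exact: lt0r_neq0.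
rewrite aE -genB; apply: le_trans (gen_contraction _ _ n.+1).
by rewrite /wsum big_nat_recr//= lerDr; exact: wsum_ge0.
Qed.

End Colligation.

(** * The multiplier *)

Section PowerSums.
Context {R : realType} {V : hilbertType R}.
Variable w : nat -> R.
Hypothesis hw : weight_sequence w.

Let w_gt0 k : 0 < w k. Proof. by case: hw => -[]. Qed.

Lemma weight_le1 k : w k <= 1.
Proof.
case: hw => -[w0 _ w_dec _] _ _ _.
by elim: k => [|k]; [rewrite w0|exact: le_trans].
Qed.

Lemma weight_inv_ge1 k : 1 <= (w k)^-1.
Proof. by rewrite invf_ge1// weight_le1. Qed.

(** A bound shared by the sequences of [A2], those of [H2] and the coefficients of [theta]; with
    [weight_power] it gives geometric convergence at each point of the disc. *)
Definition growth (a : nat -> V) (K : R) : Prop := forall n, nm (a n) <= K * (w n)^-1.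

(** The condition on [v] covers both [v = w] and [v = 1], as [w n <= 1]. *)
Lemma growth_sqsum v (a : nat -> V) M : (forall n, w n ^+ 2 <= v n) ->
  (forall N, wsum v a N <= M) -> growth a (Num.sqrt M).
Proof.
move=> wv aM n.
have v0 k : 0 <= v k by apply: le_trans (wv k); exact: sqr_ge0.
have wn2 : 0 < w n ^+ 2 by rewrite exprn_gt0.
have an : w n ^+ 2 * nsq (a n) <= M.
  apply: le_trans (aM n.+1); rewrite /wsum big_nat_recr//=.
  apply: (@le_trans _ _ (v n * nsq (a n))); first by rewrite ler_wpM2r ?nsq_ge0.
  by rewrite lerDr sumr_ge0// => k _; rewrite mulr_ge0 ?nsq_ge0.
have M0 : 0 <= M by apply: le_trans an; rewrite mulr_ge0 ?nsq_ge0// ltW.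
apply: ler_nm; first by rewrite mulr_ge0 ?sqrtr_ge0// invr_ge0 ltW.
by rewrite exprMn sqr_sqrtr// exprVn ler_pdivlMr// mulrC.
Qed.

Lemma sqsum_growth_w (a : nat -> V) : sqsum w a -> exists K, growth a K.
Proof.
move=> [M aM]; exists (Num.sqrt M); apply: growth_sqsum aM => n.
by rewrite expr2 ler_piMr ?weight_le1// ltW.
Qed.

Lemma sqsum_growth_1 (a : nat -> V) : sqsum (fun=> 1) a -> exists K, growth a K.
Proof.
move=> [M aM]; exists (Num.sqrt M); apply: growth_sqsum aM => n.
by rewrite expr2 mulr_ile1 ?weight_le1// ltW.
Qed.

(** [K] and [q] depend on [z] alone; this uniformity in [a] later yields convergence in operator
    norm. *)
Lemma growth_term (z : @disc R) : exists K q, [/\ 0 <= K, 0 <= cmod (sval z), cmod (sval z) < q, q < 1 &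
  forall (a : nat -> V) M, 0 <= M -> growth a M -> forall n, nm (sval z ^+ n *: a n) <= M * K * q ^+ n].
Proof.
have z01 : 0 <= cmod (sval z) < 1 by rewrite cmod_ge0 disc_cmod.
have [K [q [K0 zq q1 wK]]] := weight_power hw z01.
exists K, q; split=> // [|a M M0 aM n]; first exact: cmod_ge0.
rewrite nmZ cmodX mulrC.
apply: le_trans (ler_wpM2r (exprn_ge0 n (cmod_ge0 _)) (aM n)) _.
by rewrite -!mulrA ler_wpM2l.
Qed.

Lemma growth_ge0 (a : nat -> V) M : growth a M -> 0 <= M.
Proof.
move=> /(_ 0%N); case: hw => -[-> _ _ _] _ _ _.
by rewrite invr1 mulr1; apply: le_trans; exact: nm_ge0.
Qed.

Definition psum (a : nat -> V) : disc -> V :=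
  fun z => lim (series (fun k => sval z ^+ k *: a k) @ \oo).

Lemma psum_expansion a K : growth a K -> power_expansion (psum a) a.
Proof.
move=> aK z; have [C [q [C0 z0 zq q1 h]]] := growth_term z.
apply: (@geometric_series_cvg _ _ _ (K * C) q).
  by rewrite q1 andbT (le_trans z0)// ltW.
by apply: h => //; exact: growth_ge0 aK.
Qed.

Lemma power_expansion_fun (f g : disc -> V) a :
  power_expansion f a -> power_expansion g a -> f = g.
Proof. by move=> fa ga; apply/funext => z; exact: hcvg_unique (fa z) (ga z). Qed.

Lemma A2_carrierP v (S : set V) f : (forall k, 0 < v k) ->
  carrier (A2 v S) f <-> exists a, [/\ power_expansion f a, forall k, S (a k) & sqsum v a].
Proof.
move=> v0; split=> [[a fa /(ell2w_setE v0)[Sa sa]]|[a [fa Sa sa]]]; first by exists a.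
by exists a => //; apply/(ell2w_setE v0).
Qed.

Lemma A2_ipE v (S : set V) f g a b : (forall k, 0 < v k) ->
    power_expansion f a -> power_expansion g b -> sqsum v a -> sqsum v b ->
  ip (A2 v S) f g = rwip v a b +i* rwip v a ('i *: b).
Proof.
by move=> v0 fa gb sa sb; rewrite /= (coefficientsE fa) (coefficientsE gb) ell2w_ipE.
Qed.

Lemma A2_ip_norm v (S : set V) f a : (forall k, 0 < v k) ->
  power_expansion f a -> sqsum v a -> ip (A2 v S) f f = (rwip v a a)%:C.
Proof. by move=> v0 fa sa; rewrite (A2_ipE S v0 fa fa sa sa) rwip_i. Qed.

Definition shiftc (a : nat -> V) : nat -> V := fun n => if n is m.+1 then a m else 0.

Lemma Mz_expansion f a : power_expansion f a -> power_expansion (Mz f) (shiftc a).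
Proof.
move=> fa z; rewrite -(cvg_shiftS (series _)).
have -> : (fun n => series (fun k => sval z ^+ k *: shiftc a k) n.+1) =
    (fun n => sval z *: series (fun k => sval z ^+ k *: a k) n).
  apply/funext => n; rewrite /series /= big_nat_recl// scaler0 add0r scaler_sumr.
  by apply: eq_bigr => k _; rewrite scalerA -exprS.
by apply: cvgZ (fa z); exact: cvg_cst.
Qed.

Lemma shiftc_sqsum a : sqsum w a -> sqsum w (shiftc a).
Proof.
move=> [M aM]; exists M => -[|N]; first by rewrite /wsum big_geq//; apply: le_trans (wsum_ge0 w_gt0 a 0) (aM 0%N).
rewrite /wsum big_nat_recl//= nsq0 mulr0 add0r; apply: le_trans (aM N).
apply: ler_sum => k _; rewrite ler_wpM2r ?nsq_ge0//.
by case: hw => -[].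
Qed.

End PowerSums.

Arguments psum_expansion {R V w} hw {a K} _ z _ _.
Arguments Mz_expansion {R V f a} _ z _ _.

(** * Expansion of the symbol and its action on power series *)

Section Multiplier.
Context {R : realType} {H E : hilbertType R}.
Variable w : nat -> R.
Variables (Ts D0 : H -> H) (B : E -> H) (D : E -> nat -> H) (S : set H).
Hypothesis col : colligation w Ts D0 B D S.
Local Notation Theta := (theta_coef w Ts D0 B D).
Local Notation thc := (theta_conv w Ts D0 B D).
Local Notation pic := (pi_coef w Ts D0).
Local Notation gen := (joint_coef w Ts D0 B D).
Local Notation out := (output w Ts D0 D).
Implicit Types (z : @disc R) (x : E) (h : H).

Let hw := col_weight col.
Let w0 : w 0%N = 1. Proof. by case: hw => -[]. Qed.
Let w_gt0 k : 0 < w k. Proof. by case: hw => -[]. Qed.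
Let one_gt0 (k : nat) : 0 < (1 : R). Proof. exact: ltr01. Qed.
Let linT := col_linT col.
Let linD0 := col_linD0 col.
Let linB := col_linB col.
Let linD := col_linD col.

Lemma thc_contraction (x : nat -> E) N :
  wsum w (thc x) N <= \sum_(0 <= k < N) nsq (x k).
Proof.
by have := gen_contraction col 0 x N; rewrite (gen_thc col) nsq0 add0r.
Qed.

(** An input concentrated at time 0 has the numbers [Theta n x] as its response, so contractivity of
    [thc] bounds them all by the norm of [x]. *)
Lemma Theta_growth x : growth w (Theta^~ x) (nm x).
Proof.
pose xs : nat -> E := fun k => if k is 0%N then x else 0.
have -> : Theta^~ x = thc xs.
  apply/funext => n; rewrite /theta_conv big_nat_recl// subn0 big1 ?addr0// => k _ /=.
  rewrite /theta_coef (islin0 (linD _)) scaler0 add0r.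
  case: (n - k.+1)%N => // m.
  by rewrite (islin0 linB) (islin0 (islin_iter m linT)) (islin0 linD0) scaler0.
rewrite /nm; apply: (growth_sqsum hw (v := w)) => [n|N].
  by rewrite expr2 ler_piMr ?(weight_le1 hw)// ltW.
apply: le_trans (thc_contraction xs N) _; case: N => [|N].
  by rewrite big_geq// nsq_ge0.
by rewrite big_nat_recl// big1 ?addr0// => k _ /=; rewrite nsq0.
Qed.

Lemma out_le h x n : nsq (out h x n) <= nsq h + nsq x.
Proof.
rewrite -(out_isometry col); apply: (@le_trans _ _ (wsum (fun=> 1) (out h x) n.+1)).
  by rewrite /wsum big_nat_recr//= mul1r lerDr; exact: (wsum_ge0 one_gt0).
apply: le_trans (wsum_le_rwip one_gt0 _ (out_sqsum col h x)) _.
by rewrite lerDr nsq_ge0.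
Qed.

Lemma D0_le h : nm (D0 h) <= nm h.
Proof.
apply: ler_nm; rewrite ?nm_ge0// nm2; have := out_le h 0 0.
by rewrite /output (islin0 (linD _)) nsq0 /= sqrtr1 scale1r !addr0.
Qed.

Lemma D_le x n : nm (D x n) <= nm x.
Proof.
apply: ler_nm; rewrite ?nm_ge0// nm2; have := out_le 0 x n.
by rewrite /output (islin0 (islin_iter n linT)) (islin0 linD0) nsq0 scaler0 !add0r.
Qed.

Lemma col_le h x : nsq (Ts h + B x) <= nsq h + nsq x.
Proof.
rewrite -(out_isometry col) lerDl; apply: (rwip_ge0 one_gt0).
exact: out_sqsum col h x.
Qed.

Lemma iter_Ts_le n h : nm (iter n Ts h) <= nm h.
Proof.
elim: n => //= n; apply: le_trans; apply: ler_nm; rewrite ?nm_ge0// nm2.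
by have := col_le (iter n Ts h) 0; rewrite (islin0 linB) nsq0 !addr0.
Qed.

Lemma B_le x : nm (B x) <= nm x.
Proof.
apply: ler_nm; rewrite ?nm_ge0// nm2.
by have := col_le 0 x; rewrite (islin0 linT) nsq0 !add0r.
Qed.

Lemma sqrt_rho_le n : Num.sqrt (rho w n) <= (w n)^-1.
Proof.
have wV : 0 <= (w n)^-1 by rewrite invr_ge0 ltW.
rewrite -(@ler_pXn2r _ 2) ?nnegrE ?sqrtr_ge0// (sqrt_rho col).
(* [rho n <= 1 / w n <= (1 / w n) ^+ 2], the last because [w n <= 1]. *)
apply: (@le_trans _ _ ((w n)^-1)).
  by case: n wV => [|n _] /=; [rewrite w0 invr1|rewrite lerBlDr lerDl invr_ge0 ltW].
by rewrite expr2 ler_peMr// (weight_inv_ge1 hw).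
Qed.

(** [theta_fun] with abstract operators; instantiated at [adjoint T] and [defect w T] it is
    convertible to it. *)
Definition thetaf (z : disc) (x : E) : H :=
  lim (series (fun n => ((Num.sqrt (rho w n))%:C * sval z ^+ n) *: D x n) @ \oo)
  + sval z *: D0 (lim (series (fun n =>
      ((w n)^-1%:C * sval z ^+ n) *: iter n Ts (B x)) @ \oo)).

Lemma thetaf_expansion z x :
  series (fun k => sval z ^+ k *: Theta k x) @ \oo --> thetaf z x.
Proof.
have g1 : growth w (fun n => (Num.sqrt (rho w n))%:C *: D x n) (nm x).
  move=> n; rewrite nmZ cmod_real ?sqrtr_ge0// mulrC.
  by apply: ler_pM; rewrite ?nm_ge0 ?sqrtr_ge0 ?D_le ?sqrt_rho_le.
have g2 : growth w (fun n => (w n)^-1%:C *: iter n Ts (B x)) (nm x).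
  have wV n : 0 <= (w n)^-1 by rewrite invr_ge0 ltW.
  move=> n; rewrite nmZ cmod_real// mulrC ler_wpM2r//.
  exact: le_trans (iter_Ts_le _ _) (B_le x).
have /(_ z) c1 := psum_expansion hw g1.
have /(_ z) c2 := psum_expansion hw g2.
have e1 : thetaf z x = psum (fun n => (Num.sqrt (rho w n))%:C *: D x n) z +
    sval z *: D0 (psum (fun n => (w n)^-1%:C *: iter n Ts (B x)) z).
  rewrite /thetaf /psum.
  have sw (c : nat -> R[i]) (y : nat -> H) :
      (fun n => (c n * sval z ^+ n) *: y n) = (fun n => sval z ^+ n *: (c n *: y n)).
    by apply/funext => n; rewrite scalerA mulrC.
  by rewrite !sw.
rewrite e1 -(cvg_shiftS (series _)).
(* The factor [z] delays the second series by one index: [n.+1] terms of the first go with [n] terms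
   of the second. *)
have -> : (fun n => series (fun k => sval z ^+ k *: Theta k x) n.+1) =
   (fun n => series (fun n => sval z ^+ n *: ((Num.sqrt (rho w n))%:C *: D x n)) n.+1 +
     sval z *: D0 (series (fun n => sval z ^+ n *: ((w n)^-1%:C *: iter n Ts (B x))) n)).
  apply/funext => N; rewrite /series /= (islin_sum linD0) scaler_sumr.
  rewrite !big_nat_recl//= /theta_coef addr0 -addrA; congr (_ + _).
  rewrite -big_split; apply: eq_bigr => k _ /=.
  rewrite scalerDr !(islinZ linD0) exprS !scalerA; congr (_ + _ *: _); ring.
apply: cvgD; first by rewrite (cvg_shiftS (series _)).
apply: cvgZ; first exact: cvg_cst.
apply: (bounded_linear_cvg (M := 1)) c2; first exact: islinB.
by move=> h; rewrite mul1r D0_le.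
Qed.

Arguments thetaf_expansion : clear implicits.

Lemma Theta_lin n : islin (Theta n).
Proof.
move=> a x y; rewrite /theta_coef (linD n) scalerDr !scalerA (mulrC _ a) -!scalerA.
case: n => [|n]; first by rewrite !addr0.
rewrite linB (islin_iter n linT) linD0 !scalerDr !scalerA (mulrC _ a) -!scalerA.
by rewrite addrACA.
Qed.

Lemma thetaf_lin z : islin (thetaf z).
Proof.
move=> a x y; apply: (hcvg_unique (thetaf_expansion z _)).
have := series_linear (a := a) (thetaf_expansion z x) (thetaf_expansion z y).
suff -> : a *: (fun k => sval z ^+ k *: Theta k x) + (fun k => sval z ^+ k *: Theta k y) =
  (fun k => sval z ^+ k *: Theta k (a *: x + y)) by [].
apply/funext => k; rewrite !fctE Theta_lin.
by move: (Theta k x) (Theta k y) => p q; rewrite scalerDr !scalerA mulrC.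
Qed.

Lemma thetaf_tail z : exists K q, [/\ 0 <= K, 0 <= cmod (sval z), cmod (sval z) < q, q < 1 &
  forall x N, nm (series (fun k => sval z ^+ k *: Theta k x) N - thetaf z x) <=
    K * nm x * q ^+ N].
Proof.
have [K [q [K0 z0 zq q1 h]]] := growth_term (V := H) hw z.
have q01 : 0 <= q < 1 by rewrite q1 andbT (le_trans z0)// ltW.
have q1' : 0 < 1 - q by rewrite subr_gt0.
exists (K / (1 - q)), q; split=> // [|x N]; first by rewrite divr_ge0// ltW.
have [l cv dist] := geometric_series q01 (h _ _ (nm_ge0 x) (Theta_growth x)).
rewrite (hcvg_unique (thetaf_expansion z x) cv); apply: le_trans (dist N) _.
by rewrite le_eqVlt; apply/orP; left; apply/eqP; ring.
Qed.

Lemma thetaf_bounded z : exists K, forall x, nm (thetaf z x) <= K * nm x.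
Proof.
have [K [q [K0 _ _ _ h]]] := thetaf_tail z; exists K => x; have := h x 0%N.
by rewrite /series /= big_geq// sub0r nmN expr0 mulr1.
Qed.

Lemma col_Ssum (F : nat -> H) N : (forall k, S (F k)) -> S (\sum_(0 <= k < N) F k).
Proof.
move=> SF; elim: N => [|N IH]; first by rewrite big_geq//; exact: col_S0 col.
by rewrite big_nat_recr//=; apply: (col_SDa col).
Qed.

Lemma S_Theta n x : S (Theta n x).
Proof.
apply: (col_SDa col); first by apply: (col_SZ col); exact: col_SD col x n.
case: n => [|n]; first exact: col_S0 col.
by apply: (col_SZ col); exact: col_SD0 col _.
Qed.

Lemma S_thc (x : nat -> E) n : S (thc x n).
Proof. by apply: col_Ssum => k; exact: S_Theta. Qed.

Lemma S_pic h n : S (pic h n).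
Proof. by apply: (col_SZ col); exact: col_SD0 col _. Qed.

Lemma S_thetaf z x : S (thetaf z x).
Proof.
apply: (closed_cvg _ (col_Sclosed col) _ _ (thetaf_expansion z x)).
by apply: nearW => N; apply: col_Ssum => k; apply: (col_SZ col); exact: S_Theta.
Qed.

Lemma thcS (x : nat -> E) n :
  thc x n.+1 = Theta n.+1 (x 0%N) + thc (fun k => x k.+1) n.
Proof.
by rewrite /theta_conv big_nat_recl// subn0; congr (_ + _); apply: eq_bigr => k _; rewrite subSS.
Qed.

Lemma thc_0 (x : nat -> E) : thc x 0%N = Theta 0 (x 0%N).
Proof. by rewrite /theta_conv big_nat1. Qed.

(* Peeling off the first coefficient [a 0] gives a recursive inequality for the error, which
   avoids a general Cauchy product theorem. *)
Lemma cauchy_product_error z : exists K q, [/\ 0 <= q < 1, 0 <= K &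
  forall (M : R) (a : nat -> E) N, 0 <= M -> (forall k, nm (a k) <= M) ->
  nm (series (fun k => sval z ^+ k *: thc a k) N -
      thetaf z (series (fun k => sval z ^+ k *: a k) N)) <= M * K * q ^+ N].
Proof.
have [K [q [K0 z0 zq q1 tail]]] := thetaf_tail z.
have q0 : 0 <= q by apply: le_trans z0 (ltW zq).
have qz : 0 < q - cmod (sval z) by rewrite subr_gt0.
(* This constant [C] solves [cmod z * C + K * q = C * q], the balance between the inherited error
   and the new tail in the induction step. *)
exists (K * q / (q - cmod (sval z))), q; split; first by rewrite q0.
  by rewrite divr_ge0 ?mulr_ge0// ltW.
move=> M a N M0; elim: N a => [|N IH] a aM.
  rewrite /series /= !big_geq// (islin0 (thetaf_lin z)) subr0 nm0.
  by rewrite !mulr_ge0 ?invr_ge0 ?exprn_ge0// ltW.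
have peel (V : hilbertType R) (F : nat -> V) : series (fun k => sval z ^+ k *: F k) N.+1 =
    F 0%N + sval z *: series (fun k => sval z ^+ k *: F k.+1) N.
  rewrite /series /= big_nat_recl// scale1r scaler_sumr; congr (_ + _).
  by apply: eq_bigr => k _; rewrite scalerA exprS.
have -> : series (fun k => sval z ^+ k *: thc a k) N.+1 =
    series (fun k => sval z ^+ k *: Theta k (a 0%N)) N.+1 +
    sval z *: series (fun k => sval z ^+ k *: thc (fun k => a k.+1) k) N.
  rewrite (peel H (thc a)) (peel H (fun k => Theta k (a 0%N))) thc_0.
  rewrite -[RHS]addrA -[in RHS]scalerDr; congr (_ + _ *: _).
  rewrite /series /= -big_split; apply: eq_bigr => k _ /=.
  by rewrite thcS scalerDr.
rewrite (peel E a) [a 0%N + _]addrC (thetaf_lin z) [X in nm (X - _)]addrC opprD addrACA -scalerBr.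
apply: le_trans (nmD _ _) _; rewrite nmZ.
have h1 := tail (a 0%N) N.+1.
have h2 : cmod (sval z) * nm (series (fun k => sval z ^+ k *: thc (fun k => a k.+1) k) N -
    thetaf z (series (fun k => sval z ^+ k *: a k.+1) N)) <=
    cmod (sval z) * (M * (K * q / (q - cmod (sval z))) * q ^+ N).
  by rewrite ler_wpM2l// IH.
apply: le_trans (lerD h2 h1) _.
have h3 : K * nm (a 0%N) * q ^+ N.+1 <= K * M * q ^+ N.+1.
  by rewrite ler_wpM2r ?exprn_ge0// ler_wpM2l.
apply: le_trans (lerD (lexx _) h3) _.
rewrite le_eqVlt; apply/orP; left; apply/eqP; rewrite exprS; field.
by rewrite gt_eqF.
Qed.

(** Partial sums for [thc a] differ from [thetaf z] applied to those of [f] by an error tending to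
    0, and [thetaf z] is continuous. *)
Lemma mulop_expansion f a : power_expansion f a -> sqsum (fun=> 1) a ->
  power_expansion (mulop thetaf f) (thc a).
Proof.
move=> fa [M aM] z.
have aM' k : nm (a k) <= Num.sqrt M.
  apply: ler_nm; rewrite ?sqrtr_ge0//.
  have := aM k.+1; rewrite /wsum big_nat_recr//= mul1r => h.
  have h' : nsq (a k) <= M by apply: le_trans h; rewrite lerDr; exact: (wsum_ge0 one_gt0).
  by rewrite sqr_sqrtr// (le_trans _ h')// nsq_ge0.
have [K [q [q01 K0 err]]] := cauchy_product_error z.
have [K' thK] := thetaf_bounded z.
have c1 := bounded_linear_cvg (islinB (thetaf_lin z)) thK (fa z).
have c2 : (fun N => series (fun k => sval z ^+ k *: thc a k) N -
    thetaf z (series (fun k => sval z ^+ k *: a k) N)) @ \oo --> (0 : H).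
  apply: (hcvg_le (s := fun N => Num.sqrt M * K * q ^+ N)).
    by move=> N; rewrite subr0; apply: err => //; exact: sqrtr_ge0.
  exact: geometric_cvg0.
rewrite -[mulop _ _ _]addr0.
have -> : series (fun k => sval z ^+ k *: thc a k) =
    (fun N => thetaf z (series (fun k => sval z ^+ k *: a k) N)) +
    (fun N => series (fun k => sval z ^+ k *: thc a k) N -
      thetaf z (series (fun k => sval z ^+ k *: a k) N)).
  by apply/funext => N; rewrite fctE addrC subrK.
exact: cvgD.
Qed.

End Multiplier.

Arguments thetaf_lin {R H E w Ts D0 B D S} col z a x y.
Arguments mulop_expansion {R H E w Ts D0 B D S} col {f a} _ _ z _ _.

(** * The model space *)

Section Model.
Context {R : realType} {H E : hilbertType R}.
Variable w : nat -> R.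
Variables (Ts D0 : H -> H) (B : E -> H) (D : E -> nat -> H) (S : set H).
Hypothesis col : colligation w Ts D0 B D S.
Local Notation thc := (theta_conv w Ts D0 B D).
Local Notation pic := (pi_coef w Ts D0).
Local Notation gen := (joint_coef w Ts D0 B D).
Local Notation theta := (thetaf w Ts D0 B D).
Local Notation A2S := (A2 w S).
Implicit Types (z : @disc R) (h : H) (x : nat -> E).

Let hw := col_weight col.
Let w_gt0 k : 0 < w k. Proof. by case: hw => -[]. Qed.
Let one_gt0 (k : nat) : 0 < (1 : R). Proof. exact: ltr01. Qed.

Lemma thc_sqsum x : sqsum (fun=> 1) x -> sqsum w (thc x).
Proof.
move=> [M xM]; exists M => N; apply: le_trans (thc_contraction col x N) _.
by apply: le_trans (xM N); rewrite /wsum; under [leRHS]eq_bigr do rewrite mul1r.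
Qed.

Lemma gen_norm_le h x : sqsum (fun=> 1) x ->
  rwip w (pic h + thc x) (pic h + thc x) <= nsq h + rwip (fun=> 1) x x.
Proof.
move=> sx; apply: (rwip_norm_le w_gt0) => N.
apply: le_trans (gen_contraction col h x N) _; rewrite lerD2l.
apply: le_trans (wsum_le_rwip one_gt0 N sx).
by rewrite /wsum; under [leRHS]eq_bigr do rewrite mul1r.
Qed.

(* The bound of [gen_norm_le] at [t *: h], where [pic] is isometric, is an inequality
   linear in [t]. *)
Lemma thc_orth x h : sqsum (fun=> 1) x -> rwip w (thc x) (pic h) = 0.
Proof.
move=> sx; have st := thc_sqsum sx.
set c := rwip w _ _; set K := rwip (fun=> 1) x x - rwip w (thc x) (thc x).
have ineq (t : R) : 2 * t * c <= K.
  have := gen_norm_le (t%:C *: h) sx.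
  have := pic_isometry col (t%:C *: h).
  have -> : pic (t%:C *: h) = t%:C *: pic h.
    by have := pic_lin col t%:C h 0; rewrite (islin0 (pic_lin col)) !addr0.
  have sp := pic_sqsum col h.
  move=> iso; rewrite (rwipDD w_gt0 (sqsumZ _ sp))// iso.
  by rewrite (rwipZl w_gt0 _ sp)// (rwipC w (pic h) (thc x)) -/c /K; lra.
apply/eqP; apply: contraT => c0; have := ineq ((K + 1) / (2 * c)).
have -> : 2 * ((K + 1) / (2 * c)) * c = K + 1 by field.
by lra.
Qed.

(** In the decomposition [a = pic h + thc x] of [gen_onto], pairing with [pic h] leaves [nsq h = 0],
    so only [thc x] remains and the norm bound falls on [x] alone. *)
Lemma orth_onto a : (forall n, S (a n)) -> sqsum w a ->
    (forall h, rwip w a (pic h) = 0) ->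
  exists x, [/\ sqsum (fun=> 1) x, thc x = a & rwip (fun=> 1) x x <= rwip w a a].
Proof.
move=> Sa sa orth; have [h [x [sx genE le]]] := gen_onto col Sa sa.
have aE : a = pic h + thc x by rewrite -genE; apply/funext.
have := orth h; rewrite aE.
rewrite (rwipDl w_gt0 (pic_sqsum col h) (thc_sqsum sx) (pic_sqsum col h)).
rewrite thc_orth// addr0 (pic_isometry col) => h0.
have pic0 : pic h = 0 by rewrite (nsq_eq0 h0) (islin0 (pic_lin col)).
exists x; split => //; first by rewrite pic0 add0r.
by move: le; rewrite h0 add0r -aE.
Qed.

Definition pif h : disc -> H := fun z =>
  lim (series (fun k => ((w k)^-1%:C * sval z ^+ k) *: D0 (iter k Ts h)) @ \oo).

Lemma pif_expansion h : power_expansion (pif h) (pic h).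
Proof.
have [K pK] := sqsum_growth_w hw (pic_sqsum col h).
have -> : pif h = psum (pic h); last exact (psum_expansion hw pK).
apply/funext => z; rewrite /pif /psum.
suff -> : (fun k => ((w k)^-1%:C * sval z ^+ k) *: D0 (iter k Ts h)) =
  (fun k => sval z ^+ k *: pic h k) by [].
by apply/funext => k; rewrite scalerA mulrC.
Qed.

Arguments pif_expansion h z _ _ : clear implicits.

Lemma pif_carrier h : carrier A2S (pif h).
Proof.
apply/(A2_carrierP _ w_gt0); exists (pic h); split.
- exact: pif_expansion.
- exact: S_pic col h.
- exact: pic_sqsum col _.
Qed.

Lemma pif_lin : islin pif.
Proof.
move=> a h k; apply: (power_expansion_fun (pif_expansion _)).
rewrite (pic_lin col); apply: power_expansion_linear; exact: pif_expansion.
Qed.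

Lemma ip_pif f a h : power_expansion f a -> sqsum w a ->
  ip A2S f (pif h) = rwip w a (pic h) +i* rwip w a (pic ('i *: h)).
Proof.
move=> fa sa.
rewrite (A2_ipE S w_gt0 fa (pif_expansion h) sa (pic_sqsum col h)).
by rewrite (islinZ (pic_lin col)).
Qed.

Lemma H2_carrierP (f : disc -> E) : carrier (H2 E) f <->
  exists a, power_expansion f a /\ sqsum (fun=> 1) a.
Proof.
split=> [/(A2_carrierP f one_gt0)[a [fa _ sa]]|[a [fa sa]]]; first by exists a.
by apply/(A2_carrierP f one_gt0); exists a.
Qed.

Lemma psum_H2 x : sqsum (fun=> 1) x -> power_expansion (psum x) x.
Proof. by move=> /(sqsum_growth_1 hw)[K]; exact: psum_expansion. Qed.

Lemma mulop_carrier f : carrier (H2 E) f -> carrier A2S (mulop theta f).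
Proof.
move=> /H2_carrierP[a [fa sa]]; apply/(A2_carrierP _ w_gt0).
exists (thc a); split; [exact: (mulop_expansion col)|exact: S_thc col a|].
exact: thc_sqsum.
Qed.

Lemma bounded_op_whole (F : E -> H) (K : R) : islin F -> (forall y, S (F y)) ->
  (forall y, nm (F y) <= K * nm y) -> bounded_op (whole E) (subhilb S) F.
Proof.
move=> linF SF FK; split; first by move=> a y y' _ _; exact: linF.
  by move=> y _; exact: SF.
exists (K ^+ 2) => y _; rewrite /= !hdot_nsq -rmorphM lecR /= -(nm2 y) -exprMn.
by apply: ler_nsq.
Qed.

Lemma theta_multiplier : multiplier w S theta.
Proof.
split; last exact: mulop_carrier.
  move=> z; have [K thK] := thetaf_bounded col z.
  by apply: (bounded_op_whole (K := K)) => // *; [exact: (thetaf_lin col)|exact: (S_thetaf col)].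
exists (theta_coef w Ts D0 B D).
  move=> n; apply: (bounded_op_whole (K := (w n)^-1)).
  - exact: Theta_lin col n.
  - by move=> y; exact: S_Theta.
  - by move=> y; rewrite [leRHS]mulrC; exact: (Theta_growth col y n).
move=> z e e0; have [K [q [K0 z0 zq q1 tail]]] := thetaf_tail col z.
have q01 : 0 <= q < 1 by rewrite q1 andbT (le_trans z0)// ltW.
have /cvgrPdist_lt /(_ e e0) [N _ hN] := geometric_cvg0 K q01.
exists N => // n /hN /=; rewrite sub0r normrN => Kq y.
rewrite !normE -rmorphM lecR; apply: le_trans (tail y n) _.
rewrite mulrAC ler_wpM2r ?nm_ge0//.
exact: le_trans (ler_norm _) (ltW Kq).
Qed.

Lemma mulop_lin : linear_on (H2 E) A2S (mulop theta).
Proof.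
move=> a f g _ _; apply/funext => z.
by rewrite /mulop !fctE; exact: (thetaf_lin col z).
Qed.

(** For [f] orthogonal to the kernel, let [x] be the preimage of [theta f] with [|x| <= |theta f|].
    It differs from [f] by an element of the kernel, so Pythagoras gives
    [|f| <= |x| <= |theta f| <= |f|]. *)
Lemma theta_partial_isometry : partial_isometry (H2 E) A2S (mulop theta).
Proof.
have contr x : sqsum (fun=> 1) x -> rwip w (thc x) (thc x) <= rwip (fun=> 1) x x.
  move=> sx; have := gen_norm_le 0 sx.
  by rewrite (islin0 (pic_lin col)) nsq0 !add0r.
split.
  split; [exact: mulop_lin|exact: mulop_carrier|].
  exists 1 => f /H2_carrierP[a [fa sa]].
  rewrite (A2_ip_norm S w_gt0 (mulop_expansion col fa sa) (thc_sqsum sa)).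
  by rewrite (A2_ip_norm setT one_gt0 fa sa) mul1r lecR contr.
move=> f [/H2_carrierP[a [fa sa]] orth].
rewrite (A2_ip_norm S w_gt0 (mulop_expansion col fa sa) (thc_sqsum sa)).
rewrite (A2_ip_norm setT one_gt0 fa sa); congr (_%:C).
have [x [sx thE le]] := orth_onto (S_thc col a) (thc_sqsum sa) (fun h => thc_orth h sa).
pose d := a - x.
have sd : sqsum (fun=> 1) d by apply: (sqsumD one_gt0 sa); exact: sqsumN.
have thd : thc d = 0.
  rewrite /d (_ : a - x = (-1) *: x + a); last by rewrite scaleN1r addrC.
  by rewrite (thc_lin col) thE scaleN1r addNr.
have fd : power_expansion (psum d) d by exact: psum_H2.
have : ip (H2 E) f (psum d) = 0.
  apply: orth; split; first by apply/H2_carrierP; exists d.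
  have := mulop_expansion col fd sd; rewrite thd => e0.
  apply: (power_expansion_fun e0) => z.
  rewrite (_ : series _ = fun=> 0); first exact: cvg_cst.
  by apply/funext => N; rewrite /series /= big1// => k _; rewrite scaler0.
rewrite (A2_ipE setT one_gt0 fa fd sa sd) => /(congr1 (@complex.Re R)) /= ad0.
have xE : x = a + - d by rewrite /d opprB addrC subrK.
have : rwip (fun=> 1) x x = rwip (fun=> 1) a a + rwip (fun=> 1) d d.
  rewrite [in LHS]xE (rwipDD one_gt0 sa (sqsumN sd)) (rwipC _ a).
  rewrite (rwipNl one_gt0 sd sa) (rwipNl one_gt0 sd (sqsumN sd)) (rwipC _ d (- d)).
  by rewrite (rwipNl one_gt0 sd sd) (rwipC _ d a) ad0; lra.
have := rwip_ge0 one_gt0 sd; have := contr a sa; lra.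
Qed.

Lemma orthc_range_pif : orthc A2S (range pif) = mulop theta @` carrier (H2 E).
Proof.
apply/seteqP; split=> [g [/(A2_carrierP _ w_gt0)[a [ga Sa sa]] orth]|].
  have [|x [sx thE _]] := orth_onto Sa sa.
    move=> h; have := orth (pif h) (imageT pif h); rewrite (ip_pif h ga sa).
    by move/(congr1 (@complex.Re R)).
  have xx := psum_H2 sx.
  exists (psum x); first by apply/H2_carrierP; exists x.
  by apply: (power_expansion_fun (mulop_expansion col xx sx)); rewrite thE.
move=> _ [f Hf <-]; split; first exact: mulop_carrier.
move: Hf => /H2_carrierP[a [fa sa]] _ [h _ <-].
by rewrite (ip_pif h (mulop_expansion col fa sa) (thc_sqsum sa)) !thc_orth.
Qed.

(** The intertwining relation of [pi] in weak form: at index [m.+1] the weight [w m.+1] cancels the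
    [1 / w m.+1] in [pic k], just as [w m] does on the right. *)
Lemma rwip_shift h k :
  rwip w (shiftc (pic h)) (pic k) = rwip w (pic h) (pic (Ts k)).
Proof.
apply: rwipE; rewrite -(cvg_shiftS (series _)).
suff -> : (fun n => series (fun m => w m * rdot (shiftc (pic h) m) (pic k m)) n.+1) =
    series (fun m => w m * rdot (pic h m) (pic (Ts k) m)).
  by apply: (rwip_cvg w_gt0); exact: pic_sqsum col _.
apply/funext => N; rewrite /series /= big_nat_recl//= {1}/rdot hdotC hdot0r conjC0 mulr0 add0r.
apply: eq_bigr => m _; rewrite /pi_coef -iterSr !rdotZr !mulrA.
by rewrite !mulfV ?lt0r_neq0.
Qed.

Lemma ip_pif_pif h k : ip A2S (pif h) (pif k) = '[h, k].
Proof.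
rewrite (ip_pif k (pif_expansion h) (pic_sqsum col h)) !(pic_rwip col).
by apply: complex_eq => //=; rewrite Im_hdot.
Qed.

Lemma Mz_pif_carrier h : carrier A2S (Mz (pif h)).
Proof.
apply/(A2_carrierP _ w_gt0); exists (shiftc (pic h)); split.
- exact/Mz_expansion/pif_expansion.
- by case=> [|n]; [exact: col_S0 col|exact: S_pic col h n].
- exact/(shiftc_sqsum hw)/(pic_sqsum col).
Qed.

Lemma ip_Mz_pif h k : ip A2S (Mz (pif h)) (pif k) = '[h, Ts k].
Proof.
rewrite (ip_pif k (Mz_expansion (pif_expansion h)) (shiftc_sqsum hw (pic_sqsum col h))).
rewrite !rwip_shift !(pic_rwip col) (islinZ (col_linT col)).
by apply: complex_eq => //=; rewrite Im_hdot.
Qed.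

Lemma A2_ipBl f g h : carrier A2S f -> carrier A2S g ->
  ip A2S (f - g) (pif h) = ip A2S f (pif h) - ip A2S g (pif h).
Proof.
move=> /(A2_carrierP _ w_gt0)[a [fa _ sa]] /(A2_carrierP _ w_gt0)[b [gb _ sb]].
have sN := sqsumN sb.
have fgab : power_expansion (f - g) (a - b).
  have := power_expansion_linear (-1) gb fa.
  by rewrite !scaleN1r !(addrC (- _)).
rewrite (ip_pif h fgab (sqsumD w_gt0 sa sN)) (ip_pif h fa sa) (ip_pif h gb sb).
rewrite !(rwipDl w_gt0 sa sN) ?(rwipNl w_gt0 sb)//; exact: pic_sqsum col _.
Qed.

Lemma model_equivalence (T : H -> H) :
    (forall x y : H, '[T x, y] = '[x, Ts y] :> R[i]) ->
  unitarily_equivalent (whole H) T (subip A2S (range pif))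
    (fun f => orthproj A2S (range pif) (Mz f)).
Proof.
move=> TE; exists pif.
  split.
  - by move=> a h k _ _; exact: pif_lin.
  - by move=> h _; exists h.
  - by move=> _ [h _ <-]; exists h.
  - by move=> h k _ _; exact: ip_pif_pif.
(* [orthproj] chooses some point of [P]. Every such point has the inner products ['[T h, k]] with
   the [pif k], which determine it within the range of [pif]. *)
move=> h _; set P := [set q | range pif q /\ orthc A2S (range pif) (Mz (pif h) - q)].
have orth k q : P q -> ip A2S q (pif k) = '[T h, k].
  move=> [[l _ <-]] [_ /(_ _ (imageT pif k))].
  rewrite A2_ipBl ?ip_Mz_pif ?TE; [|exact: Mz_pif_carrier|exact: pif_carrier].
  by move/eqP; rewrite subr_eq0 => /eqP.
have PTh : P (pif (T h)).
  split; first by exists (T h).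
  split; last first.
    move=> _ [k _ <-]; rewrite A2_ipBl; [|exact: Mz_pif_carrier|exact: pif_carrier].
    by rewrite ip_Mz_pif ip_pif_pif TE subrr.
  have /(A2_carrierP _ w_gt0)[a [fa Sa sa]] := Mz_pif_carrier h.
  apply/(A2_carrierP _ w_gt0); exists ((-1) *: pic (T h) + a); split.
  - have := power_expansion_linear (-1) (pif_expansion (T h)) fa.
    by rewrite scaleN1r addrC.
  - by move=> k; apply: (col_Slin col); [exact: S_pic col (T h) k|exact: Sa].
  - by apply: (sqsumD w_gt0) => //; apply: sqsumZ; exact: pic_sqsum col _.
have : P (orthproj A2S (range pif) (Mz (pif h))) by exact: (@xgetPex _ 0 P) (ex_intro _ _ PTh).
move: (orthproj _ _ _) => q Pq; have [[l _ lq] _] := Pq.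
rewrite -lq; congr pif; apply: hdot_ext => k.
have := orth k q Pq; rewrite -lq ip_pif_pif => lk.
by rewrite !(rdotC k) /rdot lk.
Qed.

End Model.

(** * From the characteristic triple to the colligation *)

Section Main.
Context {R : realType} {H E : hilbertType R}.
Variables (w : nat -> R) (T : H -> H) (B : E -> H) (D : E -> nat -> H).
Hypothesis hw : weight_sequence w.
Hypothesis hT : hypercontraction w T.
Hypothesis hpure : pure T.
Hypothesis htriple : characteristic_triple w T B D.

Lemma hypercontraction_adjoint (x y : H) : '[T x, y] = '[x, adjoint T y] :> R[i].
Proof.
case: hT => -[linT _ _] contr _.
apply: (adjoint_exists (M := 1)) => [a u v|u]; first exact: linT.
by rewrite mul1r -lecR -!normE.
Qed.

Lemma linear_closure (F : H -> H) : islin F ->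
  forall (a : R[i]) x y, closure (range F) x -> closure (range F) y ->
  closure (range F) (a *: x + y).
Proof.
move=> linF a x y.
have clP v : closure (range F) v <->
    forall e : R, 0 < e -> exists h, nm (v - F h) < e.
  split=> [cl e e0|cl A].
    have [|_ [[h _ <-] vh]] := cl (ball v e%:C).
      by apply: nbhsx_ballx; rewrite ltcR.
    by exists h; move: vh; rewrite -ball_normE /ball_ /= normE ltcR.
  move=> /nbhs_ballP[[e e']]; rewrite /= ltcE /= => /andP[/eqP -> e0] bA.
  have [h vh] := cl e e0; exists (F h); split; first by exists h.
  by apply: bA; rewrite -ball_normE /ball_ /= normE ltcR.
move=> /clP cx /clP cy; apply/clP => e e0.
(* Half of [e] goes to each summand; the added 1 covers [a = 0]. *)
have a1 : 0 < 2 * (cmod a + 1) by rewrite mulr_gt0// ltr_wpDl// cmod_ge0.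
have [h hx] := cx (e / (2 * (cmod a + 1))) (divr_gt0 e0 a1).
have [k ky] := cy (e / 2) (divr_gt0 e0 (ltr0Sn R 1)).
exists (a *: h + k); rewrite linF opprD addrACA -scalerBr.
apply: le_lt_trans (nmD _ _) _; rewrite nmZ.
move: hx; rewrite ltr_pdivlMr//; have := cmod_ge0 a; have := nm_ge0 (x - F h).
by nra.
Qed.

Lemma colligation_of_triple :
  colligation w (adjoint T) (defect w T) B D (defect_space w T).
Proof.
case: htriple => -[linB _ _] [linD setD _] [linU setU surjU isoU].
have one_gt0 (k : nat) : 0 < (1 : R) by exact: ltr01.
have linT : islin (adjoint T).
  move=> a x y; apply: hdot_ext => z.
  rewrite /rdot hdotDr hdotZr -!hypercontraction_adjoint.
  by rewrite -hdotZr -hdotDr.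
have lB : islin B by move=> a x y; exact: linB.
have lD n : islin (D^~ n).
  by move=> a x y; have := linD a x y I I => /(congr1 (fun f => f n)).
(* Linearity comes from the unitary: as [rho 0 = 1], the defect operator is the output at index 0
   for zero input. *)
have lD0 : islin (defect w T).
  move=> a h k.
  have := linU a (h, 0) (k, 0) (conj I I) (conj I I) => /(congr1 (fun p => p.2 0%N)) /=.
  by rewrite scaler0 addr0 !fctE (islin0 (lD _)) /Cmap /= sqrtr1 !scale1r !addr0.
have outE h x : Cmap w T h + D x = output w (adjoint T) (defect w T) D h x by [].
have sq h x : sqsum (fun=> 1) (output w (adjoint T) (defect w T) D h x).
  have [_ /(ell2w_setE one_gt0)[_]] := setU (h, x) (conj I I).
  by [].
split => //.
- move=> h x; have := isoU (h, x) (h, x) (conj I I) (conj I I) => /=.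
  rewrite outE (ell2w_ip_norm one_gt0 (sq h x)) !hdot_nsq -!rmorphD.
  by move/(congr1 (@complex.Re R)).
- move=> h' y Sy sy.
  have [|[h x] _ /= [e1 e2]] := surjU (h', y).
    by split=> //=; apply/(ell2w_setE one_gt0).
  by exists h, x.
- exact: linear_closure.
- exact: closed_closure.
- by move=> h; apply: subset_closure; exists h.
- by move=> x n; have /(ell2w_setE one_gt0)[Sx _] := setD x I; exact: Sx.
Qed.

End Main.

Theorem theorem2p9 (R : realType) (w : nat -> R) (hw : weight_sequence w)
    (H : hilbertType R) (T : H -> H)
    (hT : hypercontraction w T) (hpure : pure T)
    (E : hilbertType R) (B : E -> H) (D : E -> nat -> H)
    (htriple : characteristic_triple w T B D) :
  let DT := defect_space w T in
  let theta := theta_fun w T B D in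
  let QT := range (pi_map w T) in
  [/\ partially_isometric_multiplier w DT theta,
      orthc (A2 w DT) QT = mulop theta @` carrier (H2 E)
    & unitarily_equivalent (whole H) T
        (subip (A2 w DT) QT)
        (fun f => orthproj (A2 w DT) QT (Mz f))].
Proof.
move=> DT theta QT; have col := colligation_of_triple hw hT hpure htriple.
split.
- by split; [exact: theta_multiplier col|exact: theta_partial_isometry col].
- exact: orthc_range_pif col.
- by apply: (model_equivalence col); exact: hypercontraction_adjoint hT.
Qed.
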